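(* For every $n\ge1$ there exists a constant $c=c(n)>0$, depending only on $n$, with the following property. Let $(M,\omega)$ be any closed symplectic manifold of dimension $2n$ and let $\rho$ be a Riemannian metric on $M$ compatible with $\omega$. Then there exists a constant $\delta=\delta(M,\omega,\rho)>0$ such that for every $0<\epsilon\le\delta$ and every finite cover $\mathcal U^\epsilon$ of $M$ by open subsets of diameter at most $\epsilon$ (with respect to $\rho$), $$pb(\mathcal U^\epsilon)\;\ge\;\frac{c}{\epsilon^2}.$$
   Context: A Riemannian metric $\rho$ is compatible with $\omega$ if there is an almost complex structure $J$ on $M$ with $\rho(\cdot,\cdot)=\omega(\cdot,J\cdot)$. $\{\cdot,\cdot\}$ denotes the Poisson bracket on $C^\infty(M)$ induced by $\omega$, and $\|f\|=\max_M|f|$. A partition of unity $\{f_i\}_{i\in I}$ consists of smooth non-negative functions on $M$ with sum $1$; it is subordinate to $\mathcal U=\{U_i\}_{i\in I}$ if $\mathrm{supp}(f_i)\subset U_i$ for all $i$. The Poisson bracket invariant of a finite open cover $\mathcal U=\{U_i\}_{i\in I}$ is $$pb(\mathcal U):=\inf_{\mathcal F}\ \max_{x,y\in[-1,1]^{|I|}}\Big\|\Big\{\sum_{i\in I}x_if_i,\sum_{j\in I}y_jf_j\Big\}\Big\|,$$ the infimum being over all partitions of unity $\mathcal F=\{f_i\}_{i\in I}$ subordinate to $\mathcal U$. *)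

(* Defs.v *)
From HB Require Import structures.
From mathcomp Require Import all_boot all_order all_algebra.
From mathcomp Require Import all_classical all_reals all_analysis.
Set Implicit Arguments.
Unset Strict Implicit.
Unset Printing Implicit Defensive.
Import Order.TTheory GRing.Theory Num.Theory.
Import numFieldNormedType.Exports.
Local Open Scope classical_set_scope.
Local Open Scope ring_scope.

(** * Smooth maps on open subsets of R^d *)

Definition partial (R : realType) (d : nat) (V : normedModType R)
    (a : 'I_d) (f : 'rV[R]_d -> V) (x : 'rV[R]_d) : V :=
  derive f x (delta_mx 0 a).

(* Meant for open [O]: membership of f in C^k(O, V). *)
Fixpoint Ck_on (R : realType) (d : nat) (V : normedModType R) (k : nat)
    (O : set 'rV[R]_d) (f : 'rV[R]_d -> V) : Prop :=
  match k with
  | 0 => forall x, O x -> continuous_at x f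
  | k'.+1 => (forall x, O x -> differentiable f x) /\
             (forall a : 'I_d, Ck_on k' O (partial a f))
  end.

Definition smooth_on (R : realType) (d : nat) (V : normedModType R)
    (O : set 'rV[R]_d) (f : 'rV[R]_d -> V) : Prop :=
  forall k, Ck_on k O f.

(** * Smooth manifolds *)

(* A smooth atlas, not necessarily maximal, on a space without boundary.  The
   maps [chart i] and [chart_inv i] are total functions, whose values are only
   meaningful on [chart_dom i] and on its image respectively.  [chart_at]
   chooses, for each point, a chart around it. *)
Record smooth_atlas (R : realType) (d : nat) (M : topologicalType) : Type :=
  SmoothAtlas {
  chart_idx : Type;
  chart_dom : chart_idx -> set M;
  chart : chart_idx -> M -> 'rV[R]_d;
  chart_inv : chart_idx -> 'rV[R]_d -> M;
  chart_at : M -> chart_idx;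
  chart_atP : forall p, chart_dom (chart_at p) p;
  chart_dom_open : forall i, open (chart_dom i);
  chart_img_open : forall i, open (chart i @` chart_dom i);
  chartK : forall i p, chart_dom i p -> chart_inv i (chart i p) = p;
  chart_continuous : forall i p, chart_dom i p -> continuous_at p (chart i);
  chart_inv_continuous : forall i x, (chart i @` chart_dom i) x ->
    continuous_at x (chart_inv i);
  chart_transition_smooth : forall i j,
    smooth_on (chart i @` (chart_dom i `&` chart_dom j))
      (chart j \o chart_inv i)
}.

Section Manifold.
Variables (R : realType) (d : nat) (M : topologicalType).
Variable A : smooth_atlas R d M.

Definition chart_img (i : chart_idx A) : set 'rV[R]_d :=
  chart i @` chart_dom i.

Definition overlap (i j : chart_idx A) : set 'rV[R]_d :=
  chart i @` (chart_dom i `&` chart_dom j).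

Definition transition (i j : chart_idx A) : 'rV[R]_d -> 'rV[R]_d :=
  chart j \o chart_inv i.

Definition smooth_fun (f : M -> R) : Prop :=
  forall i : chart_idx A, smooth_on (chart_img i) (f \o chart_inv i).

(** * Tensor fields *)

(* Tensor fields of rank 2 are given by their matrices of components in each
   chart.  Tangent vectors in a chart are row vectors, and a vector u in chart
   i reads u *m 'J (transition i j) x in chart j. *)
Definition local_matrices : Type := chart_idx A -> 'rV[R]_d -> 'M[R]_d.

Definition pair_at (T : local_matrices) (i : chart_idx A) (x u v : 'rV[R]_d)
    : R :=
  (u *m T i x *m v^T) 0 0.

(* Smooth fields of bilinear forms (u, v) |-> u *m T i x *m v^T. *)
Definition bilinear_field (T : local_matrices) : Prop :=
  (forall i, smooth_on (chart_img i) (T i)) /\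
  (forall i j x, overlap i j x ->
     T i x = jacobian (transition i j) x *m T j (transition i j x)
             *m (jacobian (transition i j) x)^T).

(* Smooth fields of tangent space endomorphisms u |-> u *m T i x. *)
Definition endomorphism_field (T : local_matrices) : Prop :=
  (forall i, smooth_on (chart_img i) (T i)) /\
  (forall i j x, overlap i j x ->
     T i x *m jacobian (transition i j) x =
     jacobian (transition i j) x *m T j (transition i j x)).

Definition closed_form (w : local_matrices) : Prop :=
  forall i x, chart_img i x -> forall a b c : 'I_d,
    partial a (fun y => w i y b c) x + partial b (fun y => w i y c a) x
    + partial c (fun y => w i y a b) x = 0.

Definition symplectic_form (w : local_matrices) : Prop :=
  [/\ bilinear_field w,
      forall i x, chart_img i x -> (w i x)^T = - w i x,
      forall i x, chart_img i x -> w i x \in unitmx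
    & closed_form w].

Definition riemannian_metric (g : local_matrices) : Prop :=
  [/\ bilinear_field g,
      forall i x, chart_img i x -> (g i x)^T = g i x
    & forall i x, chart_img i x -> forall v, v != 0 -> 0 < pair_at g i x v v].

Definition almost_complex_structure (J : local_matrices) : Prop :=
  endomorphism_field J /\
  (forall i x, chart_img i x -> J i x *m J i x = - 1%:M).

Definition compatible (w g : local_matrices) : Prop :=
  exists J, almost_complex_structure J /\
    forall i x, chart_img i x -> forall u v,
      pair_at g i x u v = pair_at w i x u (v *m J i x).

(** * Riemannian distance *)

(* C^1 curves [0, 1] -> M are represented by C^1 extensions to R. *)
Definition C1_curve (gamma : R -> M) : Prop :=
  continuous gamma /\
  forall (i : chart_idx A) t, chart_dom i (gamma t) ->
    derivable (chart i \o gamma) t 1 /\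
    continuous_at t (derive1 (chart i \o gamma)).

Definition speed (g : local_matrices) (gamma : R -> M) (t : R) : R :=
  let i := chart_at A (gamma t) in
  let v := derive1 (chart i \o gamma) t in
  Num.sqrt (pair_at g i (chart i (gamma t)) v v).

Definition curve_length (g : local_matrices) (gamma : R -> M) : \bar R :=
  (\int[lebesgue_measure]_(t in `[0%R, 1%R]) (speed g gamma t)%:E)%E.

(* Equal to +oo when p and q lie in different components. *)
Definition riem_dist (g : local_matrices) (p q : M) : \bar R :=
  ereal_inf [set l | exists gamma,
    [/\ C1_curve gamma, gamma 0 = p, gamma 1 = q & l = curve_length g gamma]].

Definition diameter (g : local_matrices) (U : set M) : \bar R :=
  ereal_sup [set l | exists p q, [/\ U p, U q & l = riem_dist g p q]].

(** * Poisson bracket and the invariant pb *)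

Definition grad (f : M -> R) (i : chart_idx A) (x : 'rV[R]_d) : 'rV[R]_d :=
  \row_a partial a (f \o chart_inv i) x.

(* The components of X_f, where omega(X_f, .) = - df. *)
Definition hamiltonian_vector (w : local_matrices) (f : M -> R)
    (i : chart_idx A) (x : 'rV[R]_d) : 'rV[R]_d :=
  - grad f i x *m invmx (w i x).

(* {f, g} = omega(X_g, X_f); the other sign convention gives the same pb. *)
Definition poisson_bracket (w : local_matrices) (f g : M -> R) (p : M) : R :=
  let i := chart_at A p in
  let x := chart i p in
  pair_at w i x (hamiltonian_vector w g i x) (hamiltonian_vector w f i x).

Definition sup_norm (f : M -> R) : \bar R :=
  ereal_sup [set `|f p|%:E | p in [set: M]].

Definition subordinate_partition (I : finType) (U : I -> set M)
    (f : I -> M -> R) : Prop :=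
  [/\ forall i, smooth_fun (f i),
      forall i p, 0 <= f i p,
      forall p, \sum_(i : I) f i p = 1
    & forall i, closure [set p | f i p != 0] `<=` U i].

Definition unit_cube (I : finType) (x : I -> R) : Prop :=
  forall i, -1 <= x i <= 1.

Definition bracket_max (w : local_matrices) (I : finType) (f : I -> M -> R)
    : \bar R :=
  ereal_sup [set l | exists x y : I -> R, [/\ unit_cube x, unit_cube y &
    l = sup_norm (poisson_bracket w (fun p => \sum_(i : I) x i * f i p)
                                    (fun p => \sum_(j : I) y j * f j p))]].

Definition pb (w : local_matrices) (I : finType) (U : I -> set M) : \bar R :=
  ereal_inf [set bracket_max w f | f in subordinate_partition U].

End Manifold.

(* Main.v *)
Require Import Defs.
From HB Require Import structures.
From mathcomp Require Import all_boot all_order all_algebra.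
From mathcomp Require Import all_classical all_reals all_analysis.
From mathcomp Require Import measurable_realfun fingroup perm zify ring lra.
Set Implicit Arguments.
Unset Strict Implicit.
Unset Printing Implicit Defensive.
Import Order.TTheory GRing.Theory Num.Theory.
Import numFieldNormedType.Exports.
Local Open Scope classical_set_scope.
Local Open Scope ring_scope.

(* Everything happens in one chart, in coordinates z in which the metric is the
   identity at 0; write d = 2n.  Let Q be the cube [0, s]^d with s = 4 eps.  No
   U_i meets both {z_k <= 0} and {z_k >= s}, so if F_k is the sum of the f_i
   whose U_i misses {z_k <= 0}, then F_k = 0 on the face {z_k = 0} of Q and
   F_k = 1 on the opposite face.  By Stokes the integral over Q of
   dF_1 /\ ... /\ dF_d is then 1, so |det (dF/dz)| >= s^-d at some point.  There
   the matrix P of the brackets {F_k, F_l} has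
   |det P| = det (dF/dz)^2 / |det omega|, where |det omega| = |det rho| is about
   1 by compatibility, while |det P| <= d! max |P_kl|^d: some bracket is at
   least c / s^2.  Stokes is proved in the discrete form of a telescoping sum
   over a grid, which needs only that the F_k are C^1. *)

(** * Discrete Stokes formula on a grid *)

Section Cup.
Variables (R : realType) (d : nat).
Implicit Types (W : seq 'I_d -> R) (s : seq 'I_d).

Definition alternating W := forall s1 a b s2,
  W (s1 ++ a :: b :: s2) = - W (s1 ++ b :: a :: s2).

Lemma alternating_cons W a : alternating W -> alternating (fun s => W (a :: s)).
Proof. by move=> altW s1 b c s2; rewrite -!cat_cons altW. Qed.

Lemma sum_antisym (F : 'I_d -> 'I_d -> R) :
  (forall a b, F a b = - F b a) -> \sum_a \sum_b F a b = 0.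
Proof.
move=> FN; set S := LHS.
suff : S = - S by move=> /eqP; rewrite -addr_eq0 -mulr2n mulrn_eq0/= => /eqP.
rewrite {1}/S exchange_big -sumrN; apply: eq_bigr => a _.
by rewrite -sumrN; apply: eq_bigr => b _.
Qed.

Variable t : R.

Definition step (a : 'I_d) : 'rV[R]_d := t *: delta_mx 0 a.

Lemma stepE a b : step a 0 b = t *+ (a == b).
Proof. by rewrite !mxE eqxx eq_sym mulr_natr. Qed.

(** Sum over lattice paths leaving [v]: the increments of the [Hs] along successive edges are
    multiplied, with weight [W] of the sequence of directions. This is the cubical cup product of
    the cochains dH; an alternating [W] turns it into a discrete wedge product. *)
Fixpoint cup (Hs : seq ('rV[R]_d -> R)) (v : 'rV[R]_d) W : R :=
  if Hs is H :: Hs' then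
    \sum_a (H (v + step a) - H v) * cup Hs' (v + step a) (fun s => W (a :: s))
  else W [::].

Lemma cupN Hs v W : cup Hs v (fun s => - W s) = - cup Hs v W.
Proof.
elim: Hs v W => //= H Hs IH v W; rewrite -sumrN; apply: eq_bigr => a _.
by rewrite IH mulrN.
Qed.

Lemma cup0 Hs v W : (forall s, W s = 0) -> cup Hs v W = 0.
Proof.
elim: Hs v W => [|H Hs IH] v W W0 /=; first exact: W0.
by rewrite big1// => a _; rewrite IH ?mulr0.
Qed.

Lemma cup_swap Hs v W a b : alternating W ->
  cup Hs v (fun s => W [:: a, b & s]) = - cup Hs v (fun s => W [:: b, a & s]).
Proof.
move=> altW; rewrite -cupN; congr cup; apply/funext => s.
exact: (altW [::]).
Qed.

(** Discrete form of d(dH_1 /\ ... /\ dH_k) = 0. Steps commute, so sums over two directions whose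
    other factors see only [v + step a + step b] cancel by antisymmetry of [W]; the rest is the
    induction hypothesis. *)
Lemma cup_closed Hs v W : alternating W ->
  \sum_a (cup Hs (v + step a) (fun s => W (a :: s))
          - cup Hs v (fun s => W (a :: s))) = 0.
Proof.
elim: Hs v W => [|H Hs IH] v W altW /=.
  by rewrite big1// => a _; rewrite subrr.
pose C w a b := cup Hs w (fun s => W [:: a, b & s]).
have CN w a b : C w a b = - C w b a by exact: cup_swap.
have E1 : \sum_a \sum_b H (v + step a + step b) * C (v + step a + step b) a b = 0.
  by apply: sum_antisym => a b; rewrite CN mulrN addrAC.
have E2 : \sum_a \sum_b H v * C (v + step a + step b) a b = 0.
  by apply: sum_antisym => a b; rewrite CN mulrN addrAC.
have E3 : \sum_a (H (v + step a) - H v) *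
    \sum_b (C (v + step a + step b) a b - C (v + step a) a b) = 0.
  rewrite big1// => a _.
  by rewrite (IH (v + step a) _ (alternating_cons a altW)) mulr0.
have E4 : \sum_a \sum_b (H (v + step b) - H v) * C (v + step b) a b =
  - \sum_a \sum_b (H (v + step a) - H v) * C (v + step a) a b.
  rewrite exchange_big -sumrN; apply: eq_bigr => a _; rewrite -sumrN.
  by apply: eq_bigr => b _; rewrite CN mulrN.
(* Here [H (v + step a)] is split as [H v] plus an increment, and the increment multiplies the
   difference of [C] that the induction hypothesis controls. *)
transitivity (\sum_a \sum_b H (v + step a + step b) * C (v + step a + step b) a b
  - \sum_a \sum_b H v * C (v + step a + step b) a b
  - \sum_a (H (v + step a) - H v) *
    \sum_b (C (v + step a + step b) a b - C (v + step a) a b)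
  - (\sum_a \sum_b (H (v + step b) - H v) * C (v + step b) a b
    + \sum_a \sum_b (H (v + step a) - H v) * C (v + step a) a b)); last first.
  by rewrite E1 E2 E3 E4 addNr !subr0.
rewrite -!sumrB -big_split -sumrB; apply: eq_bigr => a _.
rewrite -!sumrB -big_split mulr_sumr -!sumrB; apply: eq_bigr => b _ /=.
by rewrite /C; ring.
Qed.

Lemma In_map (T : eqType) (S : Type) (f : T -> S) (u : seq T) x :
  x \in u -> List.In (f x) (map f u).
Proof.
elim: u => //= y u IH; rewrite inE => /predU1P[->|xu]; [by left|right].
exact: IH.
Qed.

(** A path that uses direction [a] has weight 0; every other path stays in the hyperplane through
    [v] on which [H] is constant, so its edge for [H] has increment 0. *)
Lemma cup_face (Hs : seq ('rV[R]_d -> R)) (v : 'rV[R]_d) W H (x : R) (a : 'I_d) : List.In H Hs ->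
  (forall w : 'rV[R]_d, w 0 a = x -> H w = H v) ->
  v 0 a = x -> (forall s, a \in s -> W s = 0) -> cup Hs v W = 0.
Proof.
elim: Hs v W => [//|H' Hs IH] v W /= HHs Hx va W0.
rewrite big1// => b _; have [->|ba] := eqVneq b a.
  by rewrite cup0 ?mulr0// => s; rewrite W0// inE eqxx.
have vba : (v + step b) 0 a = x by rewrite mxE stepE (negbTE ba) addr0.
case: HHs => [->|HHs]; first by rewrite (Hx _ vba) subrr mul0r.
rewrite IH ?mulr0//; first by move=> w wa; rewrite !Hx.
by move=> s as_; rewrite W0// inE as_ orbT.
Qed.

Variable N : nat.

(** The endpoint [j = N] is left out, so each point stands for the lower corner of one cell. *)
Fixpoint grid s (phi : 'rV[R]_d -> R) (v : 'rV[R]_d) : R :=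
  if s is a :: s' then \sum_(j < N) grid s' phi (v + step a *+ j) else phi v.

Lemma grid_sum (I : finType) s (phi : I -> 'rV[R]_d -> R) v :
  grid s (fun w => \sum_i phi i w) v = \sum_i grid s (phi i) v.
Proof.
elim: s v => //= a s IH v; rewrite exchange_big; apply: eq_bigr => j _.
by rewrite IH.
Qed.

Lemma grid_eq (P : 'rV[R]_d -> Prop) s phi psi v :
  (forall w a, P w -> a \in s -> P (w + step a)) -> P v ->
  (forall w, P w -> phi w = psi w) -> grid s phi v = grid s psi v.
Proof.
elim: s v => [|a s IH] v Ps Pv e /=; first exact: e.
apply: eq_bigr => j _; apply: IH => // [w b Pw bs|].
  by apply: Ps => //; rewrite inE bs orbT.
elim: {j}(j : nat) => [|j IHj]; first by rewrite mulr0n addr0.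
by rewrite mulrSr addrA; apply: Ps => //; rewrite inE eqxx.
Qed.

Lemma grid0 s v : grid s (fun=> 0) v = 0.
Proof. by elim: s v => //= a s IH v; rewrite big1. Qed.

Lemma grid_step s phi a v :
  grid s (fun w => phi (w + step a)) v = grid s phi (v + step a).
Proof.
by elim: s v => //= b s IH v; apply: eq_bigr => j _; rewrite IH addrAC.
Qed.

Lemma gridB s phi psi v :
  grid s (fun w => phi w - psi w) v = grid s phi v - grid s psi v.
Proof.
by elim: s v => //= b s IH v; rewrite -sumrB; apply: eq_bigr => j _.
Qed.

Lemma grid_telescope s phi a v : a \in s ->
  grid s (fun w => phi (w + step a) - phi w) v =
  grid (rem a s) phi (v + step a *+ N) - grid (rem a s) phi v.
Proof.
elim: s v => //= b s IH v; rewrite inE.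
have [<- _|ba /= as_] := eqVneq a b; last first.
  rewrite -sumrB; apply: eq_bigr => j _.
  by rewrite IH// addrAC.
rewrite -[in RHS](addr0 v) -[in X in _ - X](mulr0n (step a)).
rewrite -(addrA v) add0r -(telescope_sumr (fun j => grid s phi (v + step a *+ j)))//.
rewrite big_mkord; apply: eq_bigr => j _.
by rewrite gridB grid_step mulrSr addrA.
Qed.

(** Pigeonhole, one direction at a time: some term is at least the average. The zero coordinates of
    [v] along [s] keep the point found in the cube. *)
Lemma grid_big s phi (v : 'rV[R]_d) (x side : R) : (0 < N)%N -> t * N%:R = side -> 0 <= t ->
  uniq s -> (forall a, a \in s -> v 0 a = 0) ->
  (forall a, 0 <= v 0 a <= side) ->
  x * N%:R ^+ size s <= `|grid s phi v| ->
  exists w : 'rV[R]_d, (forall a, 0 <= w 0 a <= side) /\ x <= `|phi w|.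
Proof.
move=> N0 tN t0; elim: s v => [|a s IH] v /=.
  by rewrite mulr1 => _ _ vb; exists v.
move=> /andP[as_ us] v0 vb xle.
have [j xj] : exists j : 'I_N,
    x * N%:R ^+ size s <= `|grid s phi (v + step a *+ j)|.
  apply: contrapT => /forallNP H; move: xle; apply/negP; rewrite -ltNge.
  apply: (le_lt_trans (ler_norm_sum _ _ _)).
  rewrite exprSr mulrA mulr_natr -[X in _ *+ X](card_ord N) -sumr_const.
  apply: ltr_sum => [|j _].
    by apply/hasP; exists (Ordinal N0); rewrite ?mem_index_enum.
  by have /negP := H j; rewrite -ltNge.
apply: IH xj => // [b bs|b].
  rewrite mxE v0 ?inE ?bs ?orbT// mulmxnE stepE.
  by have [eab|_] := eqVneq a b; [rewrite eab bs in as_|rewrite mul0rn addr0].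
rewrite mxE mulmxnE stepE; have [<-|_] := eqVneq a b; last by rewrite mul0rn addr0.
rewrite v0 ?inE ?eqxx// add0r mulrn_wge0//= -tN -[t *+ j]mulr_natr ler_wpM2l//.
by rewrite ler_nat ltnW.
Qed.

(* The discrete integral of [dH_0 /\ ... /\ dH_(d-1)] over the cube depends
   only on the boundary values: Stokes in the direction of the head of [s]
   leaves a single face, on which the head of [map Hf s] is 1. *)
Lemma grid_cup (Hf : 'I_d -> 'rV[R]_d -> R) s (v : 'rV[R]_d) W :
  (forall a (w : 'rV[R]_d), w 0 a = 0 -> Hf a w = 0) ->
  (forall a (w : 'rV[R]_d), w 0 a = t * N%:R -> Hf a w = 1) ->
  alternating W -> (forall u, ~~ uniq u -> W u = 0) ->
  (forall a u, a \notin s -> a \in u -> W u = 0) ->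
  uniq s -> (forall a, a \in s -> v 0 a = 0) ->
  grid s (fun w => cup (map Hf s) w W) v = W s.
Proof.
move=> H0 H1; elim: s v W => [//|a s IH] v W altW unW Ws us v0.
pose beta b w := cup (map Hf s) w (fun s => W (b :: s)).
(* On a face across [b] the function [Hf b] is constant, and [W (b :: u)] vanishes when [b] occurs
   again in [u]. *)
have beta_face b (w : 'rV[R]_d) x : b \in s -> (x = 0) \/ (x = t * N%:R) -> w 0 b = x ->
    beta b w = 0.
  move=> bs xE wb; apply: (@cup_face _ _ _ (Hf b) x b) => //.
  - exact: In_map.
  - by move=> w'; case: xE wb => -> wb w'b; [rewrite !H0|rewrite !H1].
  - by move=> u bu; rewrite unW//= bu.
have stepN b c : (v + step b *+ N) 0 c = v 0 c + (t * N%:R) *+ (b == c).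
  by rewrite mxE mulmxnE stepE mulrnAC mulr_natr.
have keep b (w : 'rV[R]_d) (u : seq 'I_d) x c : b \notin u ->
    w 0 b = x -> c \in u -> (w + step c) 0 b = x.
  move=> bu <- cu; rewrite mxE stepE; case: eqVneq => [cb|_]; last by rewrite addr0.
  by rewrite -cb cu in bu.
(* Product rule: dH_a /\ beta = d(H_a beta), because beta is closed by [cup_closed]. *)
transitivity (grid (a :: s) (fun w => \sum_b
  ((fun w => Hf a w * beta b w) (w + step b) - Hf a w * beta b w)) v).
  congr (grid _ _ _); apply/funext => w /=.
  have := cup_closed (map Hf s) w altW; rewrite -/beta => /(congr1 ( *%R (Hf a w))).
  rewrite mulr0 mulr_sumr => E; rewrite -[LHS]addr0 -[X in _ + X = _]E -big_split.
  apply: eq_bigr => b _ /=.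
  by rewrite /beta; ring.
rewrite grid_sum; set g := grid (a :: s).
(* Only [b = a] survives: for [b] in [s] the sum telescopes to two faces where [beta b] vanishes,
   and for [b] outside [a :: s] the weight is zero. *)
rewrite (bigD1 a)//= [X in _ + X]big1 ?addr0 => [|b ba]; last first.
  have [bs|bs] := boolP (b \in s); last first.
    rewrite -[RHS](grid0 (a :: s) v) -/g; congr (g _ _); apply/funext => w.
    have b0 w' : beta b w' = 0.
      by apply: cup0 => u; apply: (Ws b); rewrite !inE ?eqxx// negb_or ba.
    by rewrite !b0 !mulr0 subr0.
  have bns : b \notin rem b (a :: s) by rewrite mem_rem_uniqF.
  have bas : b \in a :: s by rewrite inE bs orbT.
  rewrite /g grid_telescope//.
  have face (w : 'rV[R]_d) x : (x = 0) \/ (x = t * N%:R) -> w 0 b = x ->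
      grid (rem b (a :: s)) (fun w => Hf a w * beta b w) w = 0.
    move=> xE wb; rewrite -[RHS](grid0 (rem b (a :: s)) w).
    apply: (@grid_eq (fun w : 'rV[R]_d => w 0 b = x)) => // [w' c w'b cs|w' w'b].
      exact: keep bns w'b cs.
    by rewrite (beta_face b w' x) ?mulr0.
  rewrite (face _ (t * N%:R)) ?(face _ 0) ?subrr//; first by left.
  - exact: v0.
  - by right.
  - by rewrite stepN v0// eqxx add0r.
rewrite /g grid_telescope ?inE ?eqxx//= eqxx.
move: us => /= /andP[as_ us].
have va : v 0 a = 0 by apply: v0; rewrite inE eqxx.
(* On the far face [Hf a] is 1 and on the near face it is 0, which leaves the sum of [beta a] over
   the far face: the case of [s] with weight [W (a :: _)]. *)
rewrite (@grid_eq (fun w : 'rV[R]_d => w 0 a = t * N%:R) _ _ (beta a)); first last.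
- by move=> w wa; rewrite H1// mul1r.
- by rewrite stepN va eqxx add0r.
- by move=> w c wa cs; exact: keep as_ wa cs.
rewrite [X in _ - X](@grid_eq (fun w : 'rV[R]_d => w 0 a = 0) _ _ (fun=> 0)); first last.
- by move=> w wa; rewrite H0// mul0r.
- by [].
- by move=> w c wa cs; exact: keep as_ wa cs.
rewrite grid0 subr0 /beta IH//.
- exact: alternating_cons.
- by move=> u uu; rewrite unW//= negb_and uu orbT.
- move=> b u bs bu; have [ba|ba] := eqVneq b a.
    by rewrite unW//= -ba bu.
  by rewrite (Ws b)// inE ?negb_or ?ba// bu orbT.
- move=> b bs; rewrite stepN v0 ?inE ?bs ?orbT//.
  by case: eqVneq => [ab|_]; [rewrite ab bs in as_|rewrite addr0].
Qed.

End Cup.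

(** * From the grid to the Jacobian determinant *)

Section Sign.
Variables (R : realType) (d : nat).

(** The Levi-Civita symbol, zero on sequences that do not enumerate all indices. Written as a sum
    over permutations, it matches the Leibniz formula term by term. *)
Definition perm_sign (s : seq 'I_d) : R :=
  \sum_(p : 'S_d) (-1) ^+ p * (s == [seq p i | i <- enum 'I_d])%:R.

Lemma eq_map_enum x0 (s : seq 'I_d) (p : 'S_d) :
  (s == [seq p i | i <- enum 'I_d]) =
  (size s == d) && [forall i : 'I_d, nth x0 s i == p i].
Proof.
have nthp (i : 'I_d) : nth x0 [seq p i | i <- enum 'I_d] i = p i.
  by rewrite (nth_map i) ?size_enum_ord ?nth_ord_enum.
apply/eqP/andP => [->|[/eqP ss /forallP sp]].
  by rewrite size_map size_enum_ord; split=> //; apply/forallP => i; rewrite nthp.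
apply: (@eq_from_nth _ x0) => [|i si]; first by rewrite size_map size_enum_ord.
by rewrite ss in si; rewrite (eqP (sp (Ordinal si))) (nthp (Ordinal si)).
Qed.

(** Swapping adjacent entries amounts to precomposing the permutation with a transposition of
    positions; reindexing the sum by it flips every sign. *)
Lemma perm_sign_alternating : alternating perm_sign.
Proof.
move=> s1 a b s2; rewrite /perm_sign.
have [sd|sd] := eqVneq (size (s1 ++ a :: b :: s2)) d; last first.
  rewrite !big1 ?oppr0// => p _; rewrite (eq_map_enum a).
    by move: sd; rewrite !size_cat /= => /negbTE ->; rewrite mulr0.
  by move: sd; rewrite !size_cat /= => /negbTE ->; rewrite mulr0.
have s1d' : ((size s1).+1 < d)%N by move: sd; rewrite size_cat /=; lia.
have s1d : (size s1 < d)%N by apply: ltn_trans s1d'.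
pose i := Ordinal s1d; pose j := Ordinal s1d'.
have ij : i != j by rewrite -val_eqE /= ltn_eqF.
rewrite -sumrN (reindex_inj (mulgI (tperm i j))) /=; apply: eq_bigr => p _.
rewrite odd_permM odd_tperm ij addTb signrN -mulNr; congr (_ * (nat_of_bool _)%:R).
have sd' : size (s1 ++ b :: a :: s2) = d by move: sd; rewrite !size_cat.
rewrite !(eq_map_enum a) sd sd' eqxx /=; apply/forallP/forallP => H k.
  have := H (tperm i j k); rewrite permM tpermK => /eqP <-; apply/eqP.
  rewrite !nth_cat; case: tpermP => [->|->|/eqP ki /eqP kj] /=.
  - by rewrite ltnn subnn ltnNge leqnSn subSnn.
  - by rewrite ltnn subnn ltnNge leqnSn subSnn.
  - case: ltnP => // sk; have [m ->] : exists m, (k - size s1 = m.+2)%N.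
      exists (k - size s1).-2; move: ki kj; rewrite -!val_eqE /=; lia.
    by [].
have := H (tperm i j k); rewrite permM => /eqP <-; apply/eqP.
rewrite !nth_cat; case: tpermP => [->|->|/eqP ki /eqP kj] /=.
- by rewrite ltnn subnn ltnNge leqnSn subSnn.
- by rewrite ltnn subnn ltnNge leqnSn subSnn.
- case: ltnP => // sk; have [m ->] : exists m, (k - size s1 = m.+2)%N.
    exists (k - size s1).-2; move: ki kj; rewrite -!val_eqE /=; lia.
  by [].
Qed.

Lemma perm_sign_uniq s : ~~ uniq s -> perm_sign s = 0.
Proof.
move=> us; rewrite /perm_sign big1// => p _; case: eqP => [sE|]; last by rewrite mulr0.
by rewrite sE map_inj_uniq ?enum_uniq// in us; exact: perm_inj.
Qed.

Lemma perm_sign_enum : perm_sign (enum 'I_d) = 1.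
Proof.
rewrite /perm_sign (bigD1 (1%g : 'S_d))//= odd_perm1 expr0 mul1r big1 => [|p p1].
  by rewrite addr0 (_ : [seq _ | i <- _] = enum 'I_d) ?eqxx// -[RHS]map_id;
    apply: eq_map => i; rewrite perm1.
case: eqP => [E|]; last by rewrite mulr0.
case/eqP: p1; apply/permP => i; rewrite perm1.
by move/eqP: E; rewrite (eq_map_enum i) => /andP[_ /forallP /(_ i)];
  rewrite nth_ord_enum => /eqP.
Qed.

(** The infinitesimal counterpart of [cup]: linear forms replace increments, and base points
    disappear. *)
Fixpoint wedge (Ls : seq ('I_d -> R)) (W : seq 'I_d -> R) : R :=
  if Ls is L :: Ls' then \sum_a L a * wedge Ls' (fun s => W (a :: s))
  else W [::].

Lemma wedge_sum (I : finType) Ls (c : I -> R) (W : I -> seq 'I_d -> R) :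
  wedge Ls (fun s => \sum_i c i * W i s) = \sum_i c i * wedge Ls (W i).
Proof.
elim: Ls W => //= L Ls IH W.
under eq_bigr do rewrite IH mulr_sumr.
rewrite exchange_big; apply: eq_bigr => i _; rewrite mulr_sumr.
by apply: eq_bigr => a _; rewrite mulrCA.
Qed.

Lemma wedge0 Ls : wedge Ls (fun=> 0) = 0.
Proof. by elim: Ls => //= L Ls IH; rewrite big1// => a _; rewrite IH mulr0. Qed.

(** By linearity in the weight it suffices to take the indicator of one permutation, for which a
    single product remains. *)
Lemma wedge_perm_sign (L : 'I_d -> 'I_d -> R) :
  wedge (map L (enum 'I_d)) perm_sign = \det (\matrix_(k, j) L k j).
Proof.
rewrite wedge_sum; apply: eq_bigr => p _; congr (_ * _).
transitivity (\prod_(k <- enum 'I_d) L k (p k)); last first.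
  by rewrite big_enum; apply: eq_bigr => k _; rewrite mxE.
elim: (enum _) => [|k ks IH] /=; first by rewrite big_nil.
rewrite big_cons (bigD1 (p k))//= big1 ?addr0 => [|a apk].
  rewrite -IH; congr (_ * wedge _ _); apply/funext => s.
  by rewrite eqseq_cons eqxx.
rewrite (_ : (fun s => _) = fun=> 0) ?wedge0 ?mulr0//; apply/funext => s.
by rewrite eqseq_cons (negbTE apk).
Qed.

End Sign.

Section Limit.
Variables (R : realType) (d : nat).

(** Step and base point form one variable, since the grid points move while the mesh is refined. *)
Definition diff_quot (h : 'rV[R]_d -> R) (a : 'I_d) (p : R * 'rV[R]_d) : R :=
  (h (p.2 + step p.1 a) - h p.2) / p.1.

Local Notation near0 z := (filter_prod (0 : R)^'+ (nbhs (z : 'rV[R]_d))).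

(** Each increment absorbs one power of the step. The base point [w] has to move for the induction:
    the later increments start at [w p + step p.1 a]. *)
Lemma cup_cvg (H : 'I_d -> 'rV[R]_d -> R) (L : 'I_d -> 'I_d -> R) z ks W
    (w : R * 'rV[R]_d -> 'rV[R]_d) :
  (forall k a, diff_quot (H k) a @ near0 z --> L k a) ->
  w @ near0 z --> z ->
  (cup p.1 (map H ks) (w p) W / p.1 ^+ size ks) @[p --> near0 z] -->
    wedge (map L ks) W.
Proof.
move=> HL; elim: ks W w => [|k ks IH] W w wz /=.
  by under eq_fun do rewrite expr0 divr1; exact: cvg_cst.
have fst_cvg : p.1 @[p --> near0 z] --> (0 : R)^'+ by exact: cvg_fst.
have fst0 : p.1 @[p --> near0 z] --> (0 : R).
  exact: cvg_trans fst_cvg (cvg_within _).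
rewrite (_ : (fun p => _) = fun p => \sum_a diff_quot (H k) a (p.1, w p) *
  (cup p.1 (map H ks) (w p + step p.1 a) (fun s => W (a :: s)) / p.1 ^+ size ks)).
  apply: cvg_big => [|a _]; first exact: add_continuous.
  apply: cvgM.
    exact: (cvg_comp _ _ (cvg_pair fst_cvg wz) (HL k a)).
  apply: IH; rewrite -[X in _ --> X]addr0; apply: cvgD => //.
  by rewrite -(scale0r (delta_mx 0 a)); apply: cvgZ => //; exact: cvg_cst.
apply/funext => p; rewrite mulr_suml; apply: eq_bigr => a _.
by rewrite /diff_quot/= exprS invfM; ring.
Qed.

(** The discrete integral is 1 on a grid of (N + 1)^d points, so at some point the normalized [cup]
    is at least [side ^- d]. These points accumulate in the compact cube, and the bound passes to
    the determinant at a cluster point. *)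
Lemma cube_det_ge (side : R) (H : 'I_d -> 'rV[R]_d -> R)
    (L : 'rV[R]_d -> 'I_d -> 'I_d -> R) : 0 < side ->
  (forall a (w : 'rV[R]_d), w 0 a = 0 -> H a w = 0) ->
  (forall a (w : 'rV[R]_d), w 0 a = side -> H a w = 1) ->
  (forall z : 'rV[R]_d, (forall a, 0 <= z 0 a <= side) ->
    forall k a, diff_quot (H k) a @ near0 z --> L z k a) ->
  exists z : 'rV[R]_d, (forall a, 0 <= z 0 a <= side) /\
    side ^- d <= `|\det (\matrix_(k, a) L z k a)|.
Proof.
move=> s0 H0 H1 HL; pose t (N : nat) : R := side / N.+1%:R.
have tN N : t N * N.+1%:R = side by rewrite divfK.
have t0 N : 0 < t N by rewrite divr_gt0.
pose c p := cup p.1 (map H (enum 'I_d)) p.2 (@perm_sign R d) / p.1 ^+ d.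
have cN N : exists w : 'rV[R]_d, (forall a, 0 <= w 0 a <= side) /\
    side ^- d <= `|c (t N, w)|.
  have := @grid_cup _ _ (t N) N.+1 H (enum 'I_d) 0 (@perm_sign R d) H0.
  rewrite tN => /(_ H1 (@perm_sign_alternating R d) (@perm_sign_uniq R d)).
  rewrite perm_sign_enum => G.
  have {}G := G _ (enum_uniq _) _.
  have [|||w [wb wE]] := @grid_big _ _ (t N) N.+1 (enum 'I_d)
    (fun w => cup (t N) (map H (enum 'I_d)) w (@perm_sign R d)) 0
    (N.+1%:R ^- d) side isT (tN N) (ltW (t0 N)) (enum_uniq _).
  - by move=> a _; rewrite mxE.
  - by move=> a; rewrite mxE lexx ltW.
  - rewrite size_enum_ord mulVf ?expf_neq0// G ?normr1// => a.
      by rewrite mem_enum.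
    by rewrite mxE.
  have td : 0 < t N ^+ d by rewrite exprn_gt0.
  exists w; split=> //; rewrite /c normrM normfV (gtr0_norm td) ler_pdivlMr//=.
  apply: le_trans wE; rewrite -(tN N) exprMn invfM mulrAC mulVf ?gt_eqF//.
  by rewrite mul1r.
have [v vP] := choice cN.
have := @rV_compact _ d (fun=> `[0, side]%classic) (fun _ => @segment_compact _ 0 side).
move=> /(_ (v @ \oo) _) [].
  by apply: (nearW (F := \oo)) => N a; rewrite /= in_itv /=; case: (vP N).
move=> z [zb zcl]; exists z; split=> [a|]; first by have := zb a; rewrite /= in_itv.
(* A smaller determinant at [z] would force the normalized [cup] below [side ^- d] for all small
   steps and all points near [z], yet some [(t N, v N)] is among these. *)
rewrite leNgt; apply/negP => zlt.
have := @cup_cvg H (L z) z (enum 'I_d) (@perm_sign R d) snd (HL z _).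
rewrite size_enum_ord wedge_perm_sign => cvgc.
have {}cvgc : c @ near0 z --> \det (\matrix_(k, a) L z k a).
  by apply: cvgc => [a|]; [have := zb a; rewrite /= in_itv|exact: cvg_snd].
have := cvgr_norm_lt _ cvgc _ zlt.
case => -[/= P Q] [P0 Qz] PQ.
have tP : \forall N \near \oo, P (t N).
  case: P0 => e /= e0 Pe; have es : 0 < e / side by rewrite divr_gt0.
  near=> N; apply: Pe => //=; rewrite sub0r normrN gtr0_norm//.
  rewrite /t mulrC -ltr_pdivlMr//.
  by near: N; exact: (near_infty_natSinv_lt (PosNum es)).
have [_ [[N PN <-] QN]] : (v @` [set N | P (t N)]) `&` Q !=set0.
  by apply: zcl => //; apply: filterS tP => N PN; exists N.
have /= := PQ (t N, v N) (conj PN QN); rewrite ltNge => /negP; apply.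
by case: (vP N).
Unshelve. all: by end_near. Qed.
End Limit.

(** * Entrywise limits of matrices, and orthonormal bases of a positive definite form *)

Section MxCvg.
Variables (R : realType) (T : Type) (F : set_system T).
Context {FF : Filter F}.

Lemma mx_cvg m n (f : T -> 'M[R]_(m, n)) (M : 'M[R]_(m, n)) :
  (forall i j, f x i j @[x --> F] --> M i j) -> f @ F --> M.
Proof.
move=> fM; apply/cvg_ballP => e e0.
have : \forall x \near F, forall i j, ball (M i j) e (f x i j).
  apply: filter_forall => i; apply: filter_forall => j.
  by move/cvg_ballP: (fM i j); exact.
by apply: filterS => x fx; split.
Qed.

Lemma entry_cvg m n (f : T -> 'M[R]_(m, n)) (M : 'M[R]_(m, n)) i j :
  f @ F --> M -> f x i j @[x --> F] --> M i j.
Proof.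
move=> fM.
exact: (cvg_comp f (fun N => N i j) fM (@coord_continuous R m n i j M)).
Qed.

Lemma mulmx_cvg m n p (f : T -> 'M[R]_(m, n)) (g : T -> 'M[R]_(n, p))
    (M : 'M[R]_(m, n)) (N : 'M[R]_(n, p)) :
  f @ F --> M -> g @ F --> N -> f x *m g x @[x --> F] --> M *m N.
Proof.
move=> fM gN; apply: mx_cvg => i j; under eq_fun do rewrite mxE.
rewrite mxE; apply: cvg_big => [|k _]; first exact: add_continuous.
by apply: cvgM; exact: entry_cvg.
Qed.

Lemma det_cvg n (f : T -> 'M[R]_n) (M : 'M[R]_n) :
  f @ F --> M -> \det (f x) @[x --> F] --> \det M.
Proof.
move=> fM; apply: cvg_big => [|p _]; first exact: add_continuous.
apply: cvgM; first exact: cvg_cst.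
apply: cvg_big => [|k _]; first exact: mul_continuous.
exact: entry_cvg.
Qed.

End MxCvg.

(** Gram-Schmidt by blocks: [C] normalizes the first basis vector and clears its row and column, and
    the Schur complement [E] is again symmetric and positive definite. *)
Lemma pos_def_orthonormal (R : rcfType) d (g : 'M[R]_d) : g^T = g ->
  (forall v : 'rV[R]_d, v != 0 -> 0 < (v *m g *m v^T) 0 0) ->
  exists2 B : 'M[R]_d, B \in unitmx & B *m g *m B^T = 1%:M.
Proof.
move=> gT gpos; suff [B BgB] : exists B : 'M[R]_d, B *m g *m B^T = 1%:M.
  by exists B => //; move: BgB; rewrite -mulmxA => /mulmx1_unit[].
elim: d g gT gpos => [|d IH] g gT gpos.
  by exists 1%:M; rewrite [LHS]flatmx0 [RHS]flatmx0.
rewrite -[d.+1]/(1 + d)%N in g gT gpos *.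
set a := g 0 0; pose b : 'rV[R]_d := ursubmx g; pose D : 'M[R]_d := drsubmx g.
have gE : g = block_mx a%:M b b^T D.
  rewrite -[LHS]submxK; congr block_mx.
    by apply/matrixP => i j; rewrite !ord1 !mxE /= !lshift0.
  by rewrite -[in LHS]gT -trmx_ursub.
have DT : D^T = D by rewrite trmx_drsub gT.
have a0 : 0 < a.
  have /gpos : (delta_mx 0 0 : 'rV[R]_(1 + d)) != 0.
    by apply/eqP => /matrixP /(_ 0 0) /eqP; rewrite !mxE eqxx oner_eq0.
  by rewrite -rowE trmx_delta -colE !mxE.
have a1 : a != 0 by rewrite gt_eqF.
pose C := block_mx (Num.sqrt a)^-1%:M 0 (- a^-1 *: b^T) 1%:M : 'M[R]_(1 + d).
pose E : 'M[R]_d := D - a^-1 *: (b^T *m b).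
have CgC : C *m g *m C^T = block_mx 1%:M 0 0 E.
  rewrite gE /C tr_block_mx !mulmx_block !trmx0 !tr_scalar_mx linearZ/= trmxK.
  rewrite !mulmx0 !mul0mx !mul1mx !mulmx1 !addr0.
  rewrite !mul_scalar_mx !mul_mx_scalar !scalerA -!scalemxAl.
  have aN : a * - a^-1 = -1 by rewrite mulrN divff.
  rewrite aN !scaleN1r !addNr mul0mx add0r scaler0 scale_scalar_mx.
  rewrite mul_scalar_mx (scalerA a) aN scaleN1r scalerN addNr; congr block_mx.
    rewrite -mulrA -[X in _ * (_ * X)](sqr_sqrtr (ltW a0)) expr2 mulKf ?mulVf//.
      by rewrite sqrtr_eq0 -ltNge.
    by rewrite sqrtr_eq0 -ltNge.
  by rewrite addrC scaleNr.
have ET : E^T = E.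
  by rewrite /E linearB/= linearZ/= trmx_mul trmxK DT.
(* Thus [row_mx 0 v *m C] is nonzero when [v] is, and positivity of [g] there is positivity of [E]
   at [v]. *)
have Cr (v : 'rV[R]_d) : rsubmx (row_mx 0 v *m C) = v.
  by rewrite /C mul_row_block row_mxKr mulmx1 mul0mx add0r.
clearbody C.
have CE : forall n (N : 'M[R]_(n, 1 + d)), N *m C *m g *m C^T = N *m block_mx 1%:M 0 0 E.
  by move=> n N; rewrite -CgC !mulmxA.
have Epos (v : 'rV[R]_d) : v != 0 -> 0 < (v *m E *m v^T) 0 0.
  move=> v0; have := gpos (row_mx 0 v *m C).
  rewrite trmx_mul mulmxA CE mul_row_block !mul0mx !mulmx0 !add0r tr_row_mx.
  rewrite mul_row_col mul0mx add0r.
  apply; apply/eqP => /(congr1 rsubmx); rewrite Cr linear0 => v00.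
  by rewrite v00 eqxx in v0.
have [B' B'E] := IH E ET Epos.
exists (block_mx 1%:M 0 0 B' *m C).
rewrite trmx_mul mulmxA CE tr_block_mx !mulmx_block !trmx0.
rewrite !mulmx0 !mul0mx !trmx1 !mulmx1 !addr0 !add0r.
by rewrite !mul0mx B'E -scalar_mx_block.
Qed.

(** * Directional derivatives and C^1 functions *)

Lemma lincomb_cvg (R : realType) (T : Type) (F : set_system T) (FF : Filter F)
    (I : finType) (c : I -> R) (f : I -> T -> R) (l : I -> R) :
  (forall i, f i @ F --> l i) ->
  \sum_i c i *: f i x @[x --> F] --> \sum_i c i *: l i.
Proof.
move=> fl; apply: cvg_big => [|i _]; first exact: add_continuous.
by apply: cvgZ; [exact: cvg_cst|exact: fl].
Qed.

Lemma near_dist (R : realType) (T : Type) (F : set_system T) (FF : Filter F)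
    (f : T -> R) l e : f @ F --> l -> 0 < e -> \forall x \near F, `|l - f x| < e.
Proof. by move=> /cvgrPdist_lt fl e0; exact: fl. Qed.

Section Derivative.
Variables (R : realType) (d : nat).

Lemma derive_partial (V : normedModType R) (f : 'rV[R]_d -> V) x u : differentiable f x ->
  'D_u f x = \sum_a u 0 a *: partial a f x.
Proof.
move=> df; rewrite deriveE// [in LHS](row_sum_delta u) linear_sum.
by apply: eq_bigr => a _; rewrite linearZ /partial deriveE.
Qed.

Lemma is_derive_line (V : normedModType R) (f : 'rV[R]_d -> V) x u (s : R) :
  derivable f (x + s *: u) u ->
  is_derive s 1 (fun r : R => f (x + r *: u)) ('D_u f (x + s *: u)).
Proof.
have E : (fun h : R => h^-1 *: ((fun r : R => f (x + r *: u)) (h *: (1 : R) + s)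
    - f (x + s *: u))) =
  (fun h : R => h^-1 *: (f (h *: u + (x + s *: u)) - f (x + s *: u))).
  apply/funext => h; congr (_ *: (f _ - _)).
  by rewrite [h *: (1 : R)]mulr1 scalerDl addrCA.
by move=> df; apply: DeriveDef; rewrite /derivable /derive /= E.
Qed.

Definition C1_on (O : set 'rV[R]_d) (f : 'rV[R]_d -> R) :=
  (forall x, O x -> differentiable f x) /\
  (forall a x, O x -> continuous_at x (partial a f)).

Lemma smooth_C1 O f : smooth_on O f -> C1_on O f.
Proof. by move=> /(_ 1%N)[df cf]; split=> // a x Ox; exact: cf. Qed.

Lemma C1_on0 O : C1_on O 0.
Proof.
split=> [x _|a x _]; first exact: differentiable_cst.
have -> : partial a (0 : 'rV[R]_d -> R) = cst 0.
  by apply/funext => y; rewrite /partial derive_cst.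
exact: (@cvg_cst _ _ _ (nbhs x)).
Qed.

Lemma C1_onD O f h : open O -> C1_on O f -> C1_on O h -> C1_on O (f + h).
Proof.
move=> oO [df cf] [dh ch]; split=> [x Ox|a x Ox].
  by apply: differentiableD; [exact: df|exact: dh].
have E y : O y -> partial a f y + partial a h y = partial a (f + h) y.
  by move=> Oy; rewrite /partial deriveD//; apply: diff_derivable; [exact: df|exact: dh].
have nO : \forall y \near nbhs x, partial a f y + partial a h y = partial a (f + h) y.
  by apply: filterS E _; exact: open_nbhs_nbhs.
rewrite /continuous_at -E//; apply: cvg_trans (near_eq_cvg nO) _.
by apply: (@cvgD _ _ _ (nbhs x)); [exact: cf|exact: ch].
Qed.

Lemma C1_onZ O (c : R) f : open O -> C1_on O f -> C1_on O (c \*: f).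
Proof.
move=> oO [df cf]; split=> [x Ox|a x Ox].
  by apply: differentiableZ; exact: df.
have E y : O y -> c * partial a f y = partial a (c \*: f) y.
  by move=> Oy; rewrite /partial deriveZ//; apply: diff_derivable; exact: df.
have nO : \forall y \near nbhs x, c * partial a f y = partial a (c \*: f) y.
  by apply: filterS E _; exact: open_nbhs_nbhs.
rewrite /continuous_at -E//; apply: cvg_trans (near_eq_cvg nO) _.
by apply: (@cvgM _ _ (nbhs x)); [exact: (@cvg_cst _ _ _ (nbhs x))|exact: cf].
Qed.

Lemma C1_on_lincomb (I : finType) (T : Type) (e : 'rV[R]_d -> T) O (c : I -> R)
    (h : I -> T -> R) : open O -> (forall k, C1_on O (h k \o e)) ->
  C1_on O ((fun p => \sum_k c k * h k p) \o e).
Proof.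
move=> oO hC.
have -> : (fun p => \sum_k c k * h k p) \o e = \sum_k (c k \*: (h k \o e)).
  by apply/funext => y; rewrite fct_sumE.
apply: (big_ind (C1_on O)) => [|f1 f2|k _]; first exact: C1_on0.
- exact: C1_onD.
- exact: C1_onZ.
Qed.

(** By the mean value theorem the quotient is the derivative along [u] at a point between [p.2] and
    [p.2 + p.1 *: u], and this derivative is continuous at [x]. *)
Lemma C1_quot_cvg (O : set 'rV[R]_d) (f : 'rV[R]_d -> R) x u : open O -> O x ->
  C1_on O f ->
  (f (p.2 + p.1 *: u) - f p.2) / p.1 @[p --> filter_prod (0 : R)^'+ (nbhs x)]
    --> 'D_u f x.
Proof.
move=> oO Ox [df cf].
have Ducont : 'D_u f y @[y --> x] --> 'D_u f x.
  rewrite (derive_partial u (df _ Ox)).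
  have nO : \forall y \near nbhs x,
      \sum_a u 0 a *: partial a f y = 'D_u f y.
    near=> y; rewrite derive_partial//; apply: df.
    by near: y; exact: open_nbhs_nbhs.
  apply: cvg_trans (near_eq_cvg nO) _.
  by apply: (@lincomb_cvg R _ (nbhs x) _) => a; exact: cf.
apply/cvgrPdist_lt => e e0.
have Dn := @near_dist R _ (nbhs x) _ _ _ e Ducont e0.
have : \forall y \near x, O y /\ `|'D_u f x - 'D_u f y| < e.
  near=> y; split; first by near: y; exact: open_nbhs_nbhs.
  by near: y; exact: Dn.
move=> /nbhs_ballP[r /= r0 Hr].
have u1 : 0 < `|u| + 1 by rewrite ltr_wpDl.
(* Half of [r] is spent on the base point and half on the step; the [+ 1] guards against [u = 0]. *)
exists ([set t : R | 0 < t /\ t < r / 2 / (`|u| + 1)], ball x (r / 2)) => /=.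
  split; last by apply: nbhsx_ballx; rewrite divr_gt0.
  near=> t; split=> //; near: t; apply: nbhs_right_lt.
  by rewrite !divr_gt0.
move=> [t y] [/= [t0 tr] xy].
have seg s : 0 <= s <= t -> ball x r (y + s *: u).
  move=> /andP[s0 st]; rewrite -ball_normE /= opprD addrA.
  rewrite (le_lt_trans (ler_normB _ _))// [r]splitr ltr_leD//.
    by rewrite -ball_normE in xy.
  rewrite normrZ ger0_norm// (le_trans (_ : _ <= t * (`|u| + 1)))//.
    by rewrite ler_pM// lerDl.
  by rewrite -ler_pdivlMr// ltW.
have dl s : 0 <= s <= t ->
    is_derive s 1 (fun s : R => f (y + s *: u)) ('D_u f (y + s *: u)).
  move=> /seg/Hr[Os _]; apply: is_derive_line; apply: diff_derivable.
  exact: df.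
have [||s st E] := @MVT _ (fun s => f (y + s *: u)) (fun s => 'D_u f (y + s *: u)) 0 t t0.
- by move=> s; rewrite in_itv /= => /andP[s0 st]; apply: dl; rewrite !ltW.
- apply: derivable_within_continuous => s; rewrite in_itv /= => st.
  by case: (dl s st).
move: E; rewrite scale0r addr0 subr0 => ->; rewrite mulfK ?gt_eqF//.
have /Hr[] // : ball x r (y + s *: u).
by apply: seg; move: st; rewrite in_itv /= => /andP[? ?]; rewrite !ltW.
Unshelve. all: by end_near. Qed.

End Derivative.

Lemma derive_comp_jacobian (R : realType) m n (V : normedModType R) (f : 'rV[R]_n -> V)
    (h : 'rV[R]_m -> 'rV[R]_n) x u : differentiable h x -> differentiable f (h x) ->
  'D_u (f \o h) x = 'D_(u *m jacobian h x) f (h x).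
Proof.
move=> dh df; rewrite deriveE; last exact: differentiable_comp.
by rewrite diff_comp//= deriveE// -deriveEjacobian// deriveE.
Qed.

Lemma derive1_comp_jacobian (R : realType) m n
    (h : 'rV[R]_m -> 'rV[R]_n) (y : R -> 'rV[R]_m) t : derivable y t 1 ->
    differentiable h (y t) ->
  derive1 (h \o y) t = derive1 y t *m jacobian h (y t).
Proof.
move=> dy dh; rewrite !derive1E deriveE; last first.
  by apply: differentiable_comp => //; exact/derivable1_diffP.
rewrite diff_comp//=; last exact/derivable1_diffP.
by rewrite -deriveEjacobian// !deriveE//; exact/derivable1_diffP.
Qed.

(** * Change of chart *)

Section Charts.
Variables (R : realType) (d : nat) (M : topologicalType) (A : smooth_atlas R d M).
Implicit Types (i j : chart_idx A) (p : M) (f : M -> R) (T w : local_matrices A).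

Lemma chart_imgP i p : chart_dom i p -> chart_img i (chart i p).
Proof. by exists p. Qed.

Lemma overlapP i j p : chart_dom i p -> chart_dom j p -> overlap i j (chart i p).
Proof. by exists p. Qed.

(** Derivatives see a whole neighbourhood, so identities between chart expressions must hold near
    [x] and not only at it. *)
Lemma near_overlap i j x : overlap i j x ->
  \forall y \near nbhs x, chart_img i y /\ chart_dom j (chart_inv i y).
Proof.
move=> [p [pi pj] <-].
have nimg : \forall y \near nbhs (chart i p), chart_img i y.
  by apply: open_nbhs_nbhs; split; [exact: chart_img_open|exact: chart_imgP].
have ninv : \forall y \near nbhs (chart i p), chart_dom j (chart_inv i y).
  apply: (@chart_inv_continuous _ _ _ A i (chart i p)); first exact: chart_imgP.
  by rewrite chartK//; apply: open_nbhs_nbhs; split=> //; exact: chart_dom_open.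
by near=> y; split; near: y.
Unshelve. all: by end_near. Qed.

Lemma transitionE i j p : chart_dom i p -> transition i j (chart i p) = chart j p.
Proof. by move=> pi; rewrite /transition /= chartK. Qed.

Lemma transition_differentiable i j p : chart_dom i p -> chart_dom j p ->
  differentiable (transition i j) (chart i p).
Proof.
move=> pi pj; have [+ _] := chart_transition_smooth i j 1%N.
by apply; exact: overlapP.
Qed.

Definition C1_fun f := forall i, C1_on (chart_img i) (f \o chart_inv i).

Lemma smooth_fun_C1 f : smooth_fun A f -> C1_fun f.
Proof. by move=> fs i; apply: smooth_C1; exact: fs. Qed.

Lemma C1_fun_lincomb (I : finType) (c : I -> R) (h : I -> M -> R) :
  (forall k, C1_fun (h k)) -> C1_fun (fun p => \sum_k c k * h k p).
Proof.
by move=> hC i; apply: C1_on_lincomb => [|k]; [exact: chart_img_open|exact: hC].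
Qed.

Lemma grad_change f i j p : C1_fun f -> chart_dom i p -> chart_dom j p ->
  grad f i (chart i p) =
  grad f j (chart j p) *m (jacobian (transition i j) (chart i p))^T.
Proof.
move=> fs pi pj; apply/rowP => a; rewrite !mxE /partial.
have [df _] := fs j.
have dfj : differentiable (f \o chart_inv j) (transition i j (chart i p)).
  by rewrite transitionE//; apply: df; exact: chart_imgP.
transitivity ('D_(delta_mx 0 a) ((f \o chart_inv j) \o transition i j) (chart i p)).
  apply: near_eq_derive; have := near_overlap (overlapP pi pj).
  apply: filterS => y [_ yj]; by rewrite /transition /= chartK.
rewrite derive_comp_jacobian//; last exact: transition_differentiable.
rewrite derive_partial// transitionE//; apply: eq_bigr => b _.
by rewrite -rowE !mxE mulrC.
Qed.

Lemma pair_at_change T i j p u v : bilinear_field T ->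
  chart_dom i p -> chart_dom j p ->
  pair_at T i (chart i p) u v =
  pair_at T j (chart j p) (u *m jacobian (transition i j) (chart i p))
    (v *m jacobian (transition i j) (chart i p)).
Proof.
move=> [_ Tc] pi pj; rewrite /pair_at (Tc i j _ (overlapP pi pj)).
by rewrite transitionE// trmx_mul !mulmxA.
Qed.

(** The definition uses the chart chosen at [p], while the cube argument works in one fixed chart.
    Gradients and [w] change by the same Jacobian [S], which cancels. *)
Lemma poisson_bracket_chart w f h i p : symplectic_form w ->
  C1_fun f -> C1_fun h -> chart_dom i p ->
  poisson_bracket w f h p =
  (grad h i (chart i p) *m (invmx (w i (chart i p)))^T
    *m (grad f i (chart i p))^T) 0 0.
Proof.
move=> [wb wa wu _] fs hs pi; rewrite /poisson_bracket.
set j := chart_at A p; have pj : chart_dom j p := chart_atP A p.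
set x := chart j p; have xj : chart_img j x := chart_imgP pj.
rewrite /pair_at /hamiltonian_vector !mulNmx linearN /= trmx_mul mulmxN opprK.
rewrite -[_ *m invmx _ *m w j x]mulmxA mulVmx ?wu// mulmx1 mulmxA.
congr (_ 0 0); rewrite (grad_change hs pi pj) (grad_change fs pi pj).
set S := jacobian _ _.
have wE : w i (chart i p) = S *m w j x *m S^T.
  by rewrite (proj2 wb i j _ (overlapP pi pj)) transitionE.
(* Invertibility of [S] is read off from that of [S *m w j x *m S^T]. *)
have : w i (chart i p) \in unitmx by apply: wu; exact: chart_imgP.
rewrite wE !unitmx_mul unitmx_tr => /andP[/andP[Su wju] _].
have invE : invmx (S *m w j x *m S^T) = invmx S^T *m invmx (w j x) *m invmx S.
  apply: (can_inj (mulKmx (_ : S *m w j x *m S^T \in unitmx))).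
    by rewrite !unitmx_mul unitmx_tr Su wju.
  rewrite mulmxV ?unitmx_mul ?unitmx_tr ?Su ?wju// !mulmxA mulmxK ?unitmx_tr//.
  by rewrite mulmxK// mulmxV.
rewrite invE !trmx_mul !trmx_inv !trmxK !mulmxA.
by rewrite mulmxK ?unitmx_tr// mulmxKV.
Qed.

Lemma C1_curve_near (y : R -> M) i t : C1_curve A y -> chart_dom i (y t) ->
  \forall s \near t, chart_dom i (y s).
Proof.
move=> [yc _] yi; apply: yc.
by apply: open_nbhs_nbhs; split=> //; exact: chart_dom_open.
Qed.

Lemma speed_chart T (y : R -> M) i t : bilinear_field T -> C1_curve A y ->
  chart_dom i (y t) ->
  speed T y t = Num.sqrt (pair_at T i (chart i (y t))
    (derive1 (chart i \o y) t) (derive1 (chart i \o y) t)).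
Proof.
move=> Tb yC yi; rewrite /speed; set j := chart_at A (y t).
have yj : chart_dom j (y t) := chart_atP A (y t).
rewrite (pair_at_change _ _ Tb yi yj).
suff -> : derive1 (chart j \o y) t =
    derive1 (chart i \o y) t *m jacobian (transition i j) (chart i (y t)) by [].
rewrite -[RHS](@derive1_comp_jacobian _ _ _ (transition i j) (chart i \o y)).
- rewrite !derive1E; apply: near_eq_derive.
  have := C1_curve_near yC yi; apply: filterS => s ys /=.
  by rewrite /transition/= chartK.
- by have [_ /(_ i t yi)[]] := yC.
- exact: transition_differentiable.
Qed.

End Charts.

(** * Lower bound for the length of curves *)

(** The integral of a nonnegative function is a supremum over simple functions below it, hence
    monotone even for functions not known to be measurable, such as [speed], whose chart may jump
    along the curve. *)
Lemma ge0_le_integral_sub d (T : measurableType d) (R : realType)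
    (mu : {measure set T -> \bar R}) (D1 D2 : set T) (f1 f2 : T -> \bar R) :
  D1 `<=` D2 -> (forall x, D1 x -> (0 <= f1 x)%E) ->
  (forall x, D2 x -> (0 <= f2 x)%E) -> (forall x, D1 x -> (f1 x <= f2 x)%E) ->
  (\int[mu]_(x in D1) f1 x <= \int[mu]_(x in D2) f2 x)%E.
Proof.
move=> D12 f10 f20 f12; rewrite !ge0_integralE//.
apply: le_ereal_sup => _ [h hf1 <-]; exists h => // x.
apply: le_trans (hf1 x) _; rewrite /patch; case: ifPn => [/set_mem xD1|_].
  by rewrite ifT ?f12//; apply: mem_set; exact: D12.
by case: ifPn => // /set_mem; exact: f20.
Qed.

Section CurveLength.
Variables (R : realType) (d : nat) (M : topologicalType) (A : smooth_atlas R d M).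
Variables (g : local_matrices A) (i : chart_idx A) (x0 : 'rV[R]_d) (B : 'M[R]_d).
Hypothesis Bu : B \in unitmx.
Hypothesis gb : bilinear_field g.

Definition small (r : R) (z : 'rV[R]_d) := forall a, `|z 0 a| < r.

Definition zcoord (p : M) : 'rV[R]_d := (chart i p - x0) *m invmx B.

Definition zpoint (z : 'rV[R]_d) : M := chart_inv i (x0 + z *m B).

Variable r : R.
Hypothesis zimg : forall z, small r z -> chart_img i (x0 + z *m B).

Lemma zpoint_dom z : small r z -> chart_dom i (zpoint z).
Proof. by move=> /zimg[p pi pE]; rewrite /zpoint -pE chartK. Qed.

Lemma chart_zpoint z : small r z -> chart i (zpoint z) = x0 + z *m B.
Proof. by move=> /zimg[p pi pE]; rewrite /zpoint -pE chartK. Qed.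

Lemma zpointK z : small r z -> zcoord (zpoint z) = z.
Proof. by move=> zr; rewrite /zcoord chart_zpoint// addrAC subrr add0r mulmxK. Qed.

Lemma zcoordK p : chart_dom i p -> zpoint (zcoord p) = p.
Proof. by move=> pi; rewrite /zpoint /zcoord mulmxKV// addrC subrK chartK. Qed.

Hypothesis gpos : forall z, small r z -> forall (u : 'rV[R]_d) a,
  u 0 a ^+ 2 <= 4 * pair_at g i (x0 + z *m B) (u *m B) (u *m B).

Definition znbhd : set M := [set p | chart_dom i p /\ small r (zcoord p)].

Lemma zcoord_cvg p a : chart_dom i p ->
  zcoord q 0 a @[q --> p] --> zcoord p 0 a.
Proof.
move=> pi; apply: entry_cvg; apply: mulmx_cvg; last exact: cvg_cst.
by apply: cvgB; [exact: (@chart_continuous _ _ _ A i p pi)|exact: cvg_cst].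
Qed.

Lemma znbhd_open p : znbhd p -> \forall q \near p, znbhd q.
Proof.
move=> [pi pr].
have H1 : \forall q \near p, chart_dom i q.
  by apply: open_nbhs_nbhs; split=> //; exact: chart_dom_open.
have H2 : \forall q \near p, small r (zcoord q).
  apply: filter_forall => a; apply: (cvgr_norm_lt _ (zcoord_cvg (a := a) pi)).
  exact: pr.
by near=> q; split; near: q.
Unshelve. all: by end_near. Qed.

Lemma zpoint_continuous z : small r z -> zpoint w @[w --> z] --> zpoint z.
Proof.
move=> zr; apply: (cvg_comp (fun w => x0 + w *m B) (chart_inv i) (G := nbhs (x0 + z *m B))).
  apply: (@cvgD _ _ _ (nbhs z)); first exact: (@cvg_cst _ _ _ (nbhs z)).
  apply: (@mulmx_cvg _ _ (nbhs z)); first exact: cvg_id.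
  exact: (@cvg_cst _ _ _ (nbhs z)).
by apply: chart_inv_continuous; exact: zimg.
Qed.

Section Curve.
Variable y : R -> M.
Hypothesis yC : C1_curve A y.

Lemma zcoord_curve s a : chart_dom i (y s) ->
  is_derive s 1 (fun t => zcoord (y t) 0 a)
    ((derive1 (chart i \o y) s *m invmx B) 0 a).
Proof.
move=> ys; have [dy _] := yC.2 i s ys.
pose c (b : 'I_d) := (fun t => (chart i \o y) t 0 b).
have dc (b : 'I_d) : is_derive s 1 (c b) (derive1 (chart i \o y) s 0 b).
  apply: DeriveDef; first by move/derivable_mxP: dy; exact.
  by rewrite derive1E derive_mx// mxE.
have dz b : is_derive s 1 (invmx B b a \*: (c b - cst (x0 0 b)))
    (invmx B b a *: (derive1 (chart i \o y) s 0 b - 0)).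
  by apply: is_deriveZ; apply: is_deriveB.
have := is_derive_sum dz.
rewrite (_ : \sum_(b < d) _ = fun t => zcoord (y t) 0 a); last first.
  apply/funext => t; rewrite fct_sumE mxE; apply: eq_bigr => b _.
  by rewrite /c /= !mxE mulrC.
move=> dsum; apply: is_derive_eq dsum _; rewrite mxE; apply: eq_bigr => b _.
by rewrite subr0 mulrC.
Qed.

(** While the curve stays in [znbhd], [gpos] bounds the derivative of each z-coordinate by twice the
    speed; the fundamental theorem of calculus integrates this. *)
Lemma zcoord_curve_le t a : 0 <= t <= 1 ->
  (forall s, 0 <= s <= t -> znbhd (y s)) ->
  ((`|zcoord (y t) 0 a - zcoord (y 0) 0 a| / 2)%:E <= curve_length g y)%E.
Proof.
move=> /andP[t0 t1] yV.
have speed0 s : (0 <= (speed g y s)%:E)%E by rewrite lee_fin /speed sqrtr_ge0.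
move: t0; rewrite le_eqVlt => /predU1P[<-|t0].
  by rewrite subrr normr0 mul0r; apply: integral_ge0.
pose F s := 2^-1 * zcoord (y s) 0 a.
pose f s := 2^-1 * (derive1 (chart i \o y) s *m invmx B) 0 a.
have dF s : 0 <= s <= t -> is_derive s 1 F (f s).
  by move=> /yV[ys _]; exact: is_deriveZ (zcoord_curve a ys).
have cF s : 0 <= s <= t -> F x @[x --> s] --> F s.
  by move=> /dF[/derivable1_diffP/differentiable_continuous].
have cf : {within `[0, t], continuous f}.
  apply: continuous_in_subspaceT => s /set_mem; rewrite /= in_itv /= => st.
  have [ys _] := yV s st; have [_ dyc] := yC.2 i s ys.
  apply: cvgM; first exact: cvg_cst.
  by apply: entry_cvg; apply: mulmx_cvg; [exact: dyc|exact: cvg_cst].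
have FTC := continuous_FTC2 t0 cf.
have -> : ((`|zcoord (y t) 0 a - zcoord (y 0) 0 a| / 2)%:E =
    `|\int[lebesgue_measure]_(s in `[0%R, t]) (f s)%:E|)%E.
  rewrite (FTC F).
  - by rewrite -EFinB abse_EFin /F -mulrBr normrM [`|2^-1|]ger0_norm// mulrC.
  - split.
    + by move=> s; rewrite in_itv /= => /andP[s0 st]; case: (dF s _) => //; rewrite !ltW.
    + by apply: cvg_at_right_filter; apply: cF; rewrite lexx ltW.
    + by apply: cvg_at_left_filter; apply: cF; rewrite lexx ltW.
  - move=> s; rewrite in_itv /= => /andP[s0 st]; rewrite derive1E.
    by case: (dF s _) => //; rewrite !ltW.
apply: le_trans (le_abse_integral _ _ _) _ => //.
  apply/measurable_EFinP; apply: subspace_continuous_measurable_fun => //.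
apply: ge0_le_integral_sub => // [s|s].
  by rewrite /= !in_itv /= => /andP[-> st]; exact: le_trans st t1.
rewrite /= in_itv /= => st; have [ys yr] := yV s st.
rewrite lee_fin (speed_chart gb yC ys) /f normrM [`|2^-1|]ger0_norm//.
rewrite mulrC ler_pdivrMr// -(@ler_pXn2r _ 2)// ?nnegrE ?mulr_ge0 ?sqrtr_ge0//.
rewrite real_normK ?num_real//; set v := derive1 _ _.
have vB : v *m invmx B *m B = v by rewrite mulmxKV.
have := gpos yr (v *m invmx B) a; rewrite vB.
have -> : x0 + zcoord (y s) *m B = chart i (y s).
  by rewrite /zcoord mulmxKV// addrC subrK.
move=> H; have p0 : 0 <= pair_at g i (chart i (y s)) v v.
  by rewrite -(pmulr_rge0 _ (_ : 0 < 4))//; apply: le_trans H; exact: sqr_ge0.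
rewrite exprMn sqr_sqrtr//; apply: le_trans H _.
by rewrite mulrC -natrX.
Qed.

Hypothesis hM : hausdorff_space M.

(** So short a curve cannot leave [znbhd]. At a first exit time [T], the coordinates before [T] are
    bounded by r/4 + 2l <= r/2, so [y T] lies in the image of a closed cube, which is compact, hence
    closed in the Hausdorff space [M], and contained in [znbhd]. *)
Lemma zcoord_diff_lt (l : R) z0 z1 a : 2 * l <= r / 4 ->
  (curve_length g y < l%:E)%E -> small (r / 4) z0 -> small (r / 4) z1 ->
  y 0 = zpoint z0 -> y 1 = zpoint z1 -> z1 0 a - z0 0 a < 2 * l.
Proof.
move=> lr yl z0r z1r y0 y1.
have bound t b : 0 <= t <= 1 -> (forall s, 0 <= s <= t -> znbhd (y s)) ->
    `|zcoord (y t) 0 b - zcoord (y 0) 0 b| < 2 * l.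
  move=> t01 H; have := le_lt_trans (zcoord_curve_le b t01 H) yl.
  by rewrite lte_fin ltr_pdivrMr// mulrC.
have r0 : 0 < r.
  have := le_lt_trans (normr_ge0 _) (z0r a); by rewrite pmulr_lgt0.
have small4 z : small (r / 4) z -> small r z.
  by move=> zr b; apply: lt_le_trans (zr b) _; move: r0; lra.
have y0V : znbhd (y 0).
  by rewrite y0; split; [exact/zpoint_dom/small4|rewrite zpointK; exact: small4].
suff V s : 0 <= s <= 1 -> znbhd (y s).
  have := bound 1 a; rewrite ler01 lexx => /(_ isT V).
  by rewrite y0 y1 !zpointK; [exact: le_lt_trans (ler_norm _)|exact: small4|exact: small4].
apply: contrapT => /not_implyP[s01 sV].
pose E := [set t | 0 <= t <= 1 /\ ~ znbhd (y t)].
have Ei : has_inf E.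
  split; first by exists s.
  by exists 0 => t [/andP[]].
pose T := inf E.
have Tlb t : E t -> T <= t by move=> Et; apply: ge_inf => //; case: Ei.
have T01 : 0 <= T <= 1.
  apply/andP; split; first by apply: lb_le_inf => [|t [/andP[]]//]; exists s.
  by apply: le_trans (Tlb s _) _ => //; case/andP: s01.
have before t : 0 <= t < T -> znbhd (y t).
  move=> /andP[t0 tT]; apply: contrapT => tV.
  have t1 : t <= 1 by case/andP: T01 => _; exact: le_trans (ltW tT).
  have Tt : T <= t by apply: Tlb; split; rewrite ?t0.
  by rewrite ltNge Tt in tT.
(* As [znbhd] is open, the infimum of the exit times is itself an exit time. *)
have TV : ~ znbhd (y T).
  move=> /znbhd_open/(yC.1 T)/nbhs_ballP[e /= e0 eV].
  have [t Et tT] := inf_adherent e0 Ei.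
  apply: Et.2; apply: eV; rewrite /ball /= distrC ger0_norm ?subr_ge0 ?Tlb//.
  by rewrite ltrBlDl.
have T0 : 0 < T.
  rewrite lt_neqAle (proj1 (andP T01)) andbT; apply/eqP => T0.
  by apply: TV; rewrite -T0.
pose C := [set z : 'rV[R]_d | forall b, `[- (r / 2), r / 2]%classic (z 0 b)].
have Cr z : C z -> small r z.
  move=> zC b; have := zC b; rewrite /= in_itv /= -ler_norml => /le_lt_trans; apply.
  by move: r0; lra.
have Ccompact : compact (zpoint @` C).
  apply: continuous_compact; last first.
    exact: (@rV_compact _ d (fun=> _) (fun=> @segment_compact _ (- (r / 2)) (r / 2))).
  apply: continuous_in_subspaceT => z /set_mem/Cr; exact: zpoint_continuous.
have Cclosed : closed (zpoint @` C) by apply: compact_closed.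
have : (zpoint @` C) (y T).
  apply: contrapT => nC.
  have /(yC.1 T)/nbhs_ballP[e /= e0 eV] : \forall q \near y T, (~` (zpoint @` C)) q.
    by apply: open_nbhs_nbhs; split=> //; exact: closed_openC.
  (* A time before [T] and within [e] of it; the maximum keeps it nonnegative. *)
  pose t := Num.max 0 (T - e / 2).
  have tT : 0 <= t < T by rewrite le_max lexx gt_max T0 ltrBlDr ltrDl divr_gt0.
  have : ball T e t.
    rewrite /ball /= ger0_norm ?subr_ge0; last by case/andP: tT => _ /ltW.
    rewrite ltrBlDl -ltrBlDr lt_max; apply/orP; right.
    by move: e0; lra.
  move=> /eV; apply; exists (zcoord (y t)); last first.
    by apply: zcoordK; case: (before t tT).
  move=> b; rewrite /= in_itv /= -ler_norml.
  have := bound t b _ _; rewrite y0 zpointK; last exact: small4.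
  have t1 : 0 <= t <= 1.
    by case/andP: tT => -> /ltW/le_trans; apply; case/andP: T01.
  move=> /(_ t1); have st u : 0 <= u <= t -> znbhd (y u).
    move=> /andP[u0 ut]; apply: before; rewrite u0/= (le_lt_trans ut)//.
    by case/andP: tT.
  move=> /(_ st) H; rewrite -[zcoord _ _ _](subrK (z0 0 b)).
  apply: le_trans (ler_normD _ _) _.
  have := z0r b; move: H lr; lra.
move=> [z zC yT]; apply: TV; rewrite -yT.
by split; [exact/zpoint_dom/Cr|rewrite zpointK; exact: Cr].
Qed.

End Curve.
End CurveLength.

(** * Determinants and normal coordinates *)

(** Since 2 |u_i u_j| <= u_i^2 + u_j^2, the form differs from S = |u|^2 by at most e d S <= S/2. The
    constant 4, rather than 2, has the convenient square root used in the length estimate. *)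
Lemma sqr_le_quad_form (R : realType) d (G : 'M[R]_d) (e : R) (u : 'rV[R]_d) a :
  e * d%:R <= 2^-1 -> (forall i j, `|G i j - (i == j)%:R| <= e) ->
  u 0 a ^+ 2 <= 4 * (u *m G *m u^T) 0 0.
Proof.
move=> ed Ge; pose S := \sum_i u 0 i ^+ 2.
have uS : u 0 a ^+ 2 <= S.
  by rewrite /S (bigD1 a)//= lerDl sumr_ge0// => i _; exact: sqr_ge0.
have S0 : 0 <= S by apply: sumr_ge0 => i _; exact: sqr_ge0.
have QS : (u *m G *m u^T) 0 0 - S =
    \sum_j \sum_i (G i j - (i == j)%:R) * (u 0 i * u 0 j).
  rewrite mxE /S -sumrB; apply: eq_bigr => j _; rewrite !mxE mulr_suml.
  transitivity (\sum_i (u 0 i * G i j * u 0 j - (i == j)%:R * (u 0 i * u 0 j))).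
    rewrite sumrB; congr (_ - _); rewrite (bigD1 j)//= eqxx big1 => [|i ij].
      by rewrite mul1r addr0 expr2.
    by rewrite (negbTE ij) mul0r.
  by apply: eq_bigr => i _; ring.
have : `|(u *m G *m u^T) 0 0 - S| <= e * d%:R * S.
  rewrite QS; apply: le_trans (ler_norm_sum _ _ _) _.
  have -> : e * d%:R * S = \sum_j \sum_i e / 2 * (u 0 i ^+ 2 + u 0 j ^+ 2).
    under eq_bigr do rewrite -mulr_sumr big_split/= sumr_const card_ord -/S.
    rewrite -mulr_sumr big_split/= sumr_const card_ord -sumrMnl -/S.
    by rewrite sumrMnl -/S -mulr_natr; field.
  apply: ler_sum => j _; apply: le_trans (ler_norm_sum _ _ _) _.
  apply: ler_sum => i _; rewrite normrM -mulrA ler_pM// normrM.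
  rewrite ler_pdivlMl// -(real_normK (num_real (u 0 i))).
  rewrite -(real_normK (num_real (u 0 j))).
  by have := sqr_ge0 (`|u 0 i| - `|u 0 j|); rewrite sqrrB; lra.
have : e * d%:R * S <= 2^-1 * S by apply: ler_wpM2r.
by rewrite ler_norml => ? /andP[]; lra.
Qed.

Lemma norm_det_le (R : realType) d (P : 'M[R]_d) (m : R) :
  (forall i j, `|P i j| <= m) -> `|\det P| <= d`!%:R * m ^+ d.
Proof.
move=> Pm; apply: le_trans (ler_norm_sum _ _ _) _.
rewrite -card_Sn mulr_natl -sumr_const; apply: ler_sum => p _.
rewrite normrM normrX normrN normr1 expr1n mul1r normr_prod.
rewrite -[X in _ ^+ X](card_ord d) -prodr_const; apply: ler_prod => i _.
by rewrite normr_ge0 Pm.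
Qed.

Section NormalCoordinates.
Variables (R : realType) (n : nat) (M : topologicalType) (A : smooth_atlas R (2 * n) M).
Local Notation d := (2 * n)%N.
Implicit Types (w g : local_matrices A).

Lemma pair_at_inj (G H : 'M[R]_d) :
  (forall u v : 'rV[R]_d, (u *m G *m v^T) 0 0 = (u *m H *m v^T) 0 0) -> G = H.
Proof.
move=> E; apply/matrixP => i j; have := E (delta_mx 0 i) (delta_mx 0 j).
by rewrite !trmx_delta -!rowE -!colE !mxE.
Qed.

(** Compatibility reads g = w J^T, and J^2 = -1 gives det(J)^2 = 1 because the dimension is even. *)
Lemma compatible_norm_det w g i x : compatible w g -> chart_img i x ->
  `|\det (w i x)| = `|\det (g i x)|.
Proof.
move=> [J [[_ JJ] wJ]] xi.
have gE : g i x = w i x *m (J i x)^T.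
  apply: pair_at_inj => u v; have := wJ i x xi u v; rewrite /pair_at => ->.
  by rewrite trmx_mul !mulmxA.
have J2 : \det (J i x) ^+ 2 = 1.
  rewrite expr2 -det_mulmx JJ// -scaleN1r detZ.
  by rewrite det1 mulr1 exprM sqrrN !expr1n.
rewrite gE det_mulmx det_tr normrM.
suff -> : `|\det (J i x)| = 1 by rewrite mulr1.
have := sqrp_eq1 (normr_ge0 (\det (J i x))).
by rewrite real_normK ?num_real// J2 eqxx => /esym/eqP.
Qed.

(* In the coordinates z with [x = x0 + z B] the metric is the identity at 0. *)
Lemma metric_normalization g i x0 : riemannian_metric g -> chart_img i x0 ->
  exists2 B : 'M[R]_d, B \in unitmx & exists r : R, [/\ 0 < r,
    forall z, small r z -> chart_img i (x0 + z *m B),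
    forall z, small r z -> forall (u : 'rV[R]_d) a,
      u 0 a ^+ 2 <= 4 * pair_at g i (x0 + z *m B) (u *m B) (u *m B) &
    forall z, small r z -> `|\det (B *m g i (x0 + z *m B) *m B^T)| <= 2].
Proof.
move=> [[gs _] gT gpos] xi.
have [B Bu BgB] := pos_def_orthonormal (gT i x0 xi) (gpos i x0 xi).
exists B => //; pose G z := B *m g i (x0 + z *m B) *m B^T.
have affine : x0 + z *m B @[z --> nbhs (0 : 'rV[R]_d)] --> x0.
  rewrite [X in _ --> X](_ : x0 = x0 + 0 *m B); last by rewrite mul0mx addr0.
  apply: (@cvgD _ _ _ (nbhs (0 : 'rV[R]_d))).
    exact: (@cvg_cst _ _ _ (nbhs (0 : 'rV[R]_d))).
  apply: (@mulmx_cvg _ _ (nbhs (0 : 'rV[R]_d))); first exact: cvg_id.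
  exact: (@cvg_cst _ _ _ (nbhs (0 : 'rV[R]_d))).
have Gcvg : G @ nbhs (0 : 'rV[R]_d) --> (1%:M : 'M[R]_d).
  rewrite -BgB; apply: (@mulmx_cvg _ _ (nbhs (0 : 'rV[R]_d))); last first.
    exact: (@cvg_cst _ _ _ (nbhs (0 : 'rV[R]_d))).
  apply: (@mulmx_cvg _ _ (nbhs (0 : 'rV[R]_d))).
    exact: (@cvg_cst _ _ _ (nbhs (0 : 'rV[R]_d))).
  exact: (cvg_comp _ _ affine (gs i 0%N x0 xi)).
(* Makes e d <= 1/2, as [sqr_le_quad_form] asks; the successor keeps the denominator nonzero when d
   = 0. *)
pose e : R := (2 * d.+1%:R)^-1.
have e0 : 0 < e by rewrite invr_gt0 mulr_gt0.
have ed : e * d%:R <= 2^-1.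
  rewrite /e invfM -mulrA ler_piMr// mulrC ler_pdivrMr// mul1r ler_nat//.
have n1 : \forall z \near nbhs (0 : 'rV[R]_d), chart_img i (x0 + z *m B).
  by apply: affine; apply: open_nbhs_nbhs; split=> //; exact: chart_img_open.
have n2 : \forall z \near nbhs (0 : 'rV[R]_d),
    forall j k, `|(1%:M : 'M[R]_d) j k - G z j k| < e.
  apply: filter_forall => j; apply: filter_forall => k.
  by apply: near_dist => //; exact: (@entry_cvg _ _ (nbhs (0 : 'rV[R]_d))).
have n3 : \forall z \near nbhs (0 : 'rV[R]_d), `|\det (1%:M : 'M[R]_d) - \det (G z)| < 1.
  by apply: near_dist => //; exact: (@det_cvg _ _ (nbhs (0 : 'rV[R]_d))).
have : \forall z \near nbhs (0 : 'rV[R]_d), [/\ chart_img i (x0 + z *m B),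
    forall j k, `|(1%:M : 'M[R]_d) j k - G z j k| < e &
    `|\det (1%:M : 'M[R]_d) - \det (G z)| < 1].
  by near=> z; split; near: z.
move=> /nbhs_ballP[r /= r0 rP]; exists r.
have {}rP z : small r z -> [/\ chart_img i (x0 + z *m B),
    forall j k, `|(1%:M : 'M[R]_d) j k - G z j k| < e &
    `|\det (1%:M : 'M[R]_d) - \det (G z)| < 1].
  move=> zr; apply: rP; split=> // j k.
  by rewrite /ball /= mxE sub0r normrN ord1.
split=> // z /rP[] // _ H2 H3.
- move=> u a; have := @sqr_le_quad_form _ _ (G z) e u a ed.
  rewrite /G /pair_at trmx_mul !mulmxA; apply=> j k.
  by have := H2 j k; rewrite mxE distrC => /ltW.
- by move: H3; rewrite det1 -/(G z) ltr_norml ler_norml => /andP[? ?]; lra.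
Unshelve. all: by end_near. Qed.

Lemma bracket_le_max w (I : finType) (f : I -> M -> R) (x y : I -> R) p :
  unit_cube x -> unit_cube y ->
  (`|poisson_bracket w (fun p => \sum_i x i * f i p)%R
       (fun p => \sum_j y j * f j p)%R p|%:E <= bracket_max w f)%E.
Proof.
move=> xc yc; apply: (@le_trans _ _ (sup_norm (poisson_bracket w
  (fun p => \sum_i x i * f i p)%R (fun p => \sum_j y j * f j p)%R))).
  by apply: ereal_sup_ubound; exists p.
by apply: ereal_sup_ubound; exists x, y.
Qed.

End NormalCoordinates.

(** * The cube argument *)

Section Local.
Variables (R : realType) (n : nat) (M : topologicalType) (A : smooth_atlas R (2 * n) M).
Local Notation d := (2 * n)%N.
Variables (omega rho : local_matrices A) (i : chart_idx A) (x0 : 'rV[R]_d).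
Variables (B : 'M[R]_d) (r : R).
Hypothesis hM : hausdorff_space M.
Hypothesis omegaS : symplectic_form omega.
Hypothesis rhoR : riemannian_metric rho.
Hypothesis compat : compatible omega rho.
Hypothesis Bu : B \in unitmx.
Hypothesis zimg : forall z, small r z -> chart_img i (x0 + z *m B).
Hypothesis rho_ge : forall z, small r z -> forall (u : 'rV[R]_d) a,
  u 0 a ^+ 2 <= 4 * pair_at rho i (x0 + z *m B) (u *m B) (u *m B).
Hypothesis rho_det : forall z, small r z ->
  `|\det (B *m rho i (x0 + z *m B) *m B^T)| <= 2.

Local Notation zpt := (zpoint i x0 B).

(** The distance is an infimum, so a distance at most [eps] yields a curve shorter than [2 * eps];
    [zcoord_diff_lt] doubles this again and asks for 4 eps <= r/4. *)
Lemma small_diam_sep (eps : R) (U : set M) z0 z1 a : 0 < eps -> 16 * eps <= r ->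
  (diameter rho U <= eps%:E)%E -> U (zpt z0) -> U (zpt z1) ->
  small (r / 4) z0 -> small (r / 4) z1 -> z1 0 a - z0 0 a < 4 * eps.
Proof.
move=> e0 er Ud U0 U1 z0r z1r.
have : (riem_dist rho (zpt z0) (zpt z1) < (2 * eps)%:E)%E.
  apply: (@le_lt_trans _ _ eps%:E); last by rewrite lte_fin; lra.
  by apply: le_trans Ud; apply: ereal_sup_ubound; exists (zpt z0), (zpt z1).
move=> /ereal_inf_lt[_ [y [yC y0 y1 ->]] yl].
have [rb _ _] := rhoR.
have H := @zcoord_diff_lt R d M A rho i x0 B Bu rb r zimg rho_ge y yC hM
  (2 * eps) z0 z1 a _ yl z0r z1r y0 y1.
by rewrite (_ : 4 * eps = 2 * (2 * eps)); [apply: H; lra|ring].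
Qed.

(** At the point given by [cube_det_ge] the bracket matrix is P = Gr omega^-T Gr^T and the Jacobian
    in z is Gr B^T. Hence det(Gr B^T)^2 = |det(B omega B^T)| |det P|, where the first factor is at
    most 2 by [compatible_norm_det] and [rho_det]. *)
Lemma grid_functions (side : R) (F : 'I_d -> M -> R) : 0 < side -> side < r / 4 ->
  (forall k, C1_fun A (F k)) ->
  (forall k z, small (r / 4) z -> z 0 k <= 0 -> F k (zpt z) = 0) ->
  (forall k z, small (r / 4) z -> side <= z 0 k -> F k (zpt z) = 1) ->
  exists p, exists P : 'M[R]_d,
    (forall k l, P k l = poisson_bracket omega (F l) (F k) p) /\
    side ^- d ^+ 2 <= 2 * `|\det P|.
Proof.
move=> s0 sr FC F0 F1.
have small4 (z : 'rV[R]_d) : small (r / 4) z -> small r z.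
  by move=> zr b; apply: lt_le_trans (zr b) _; lra.
pose phi k := F k \o chart_inv i.
(* The extension by 0 and 1 makes the face conditions hold on whole hyperplanes, beyond the range of
   the chart, as [cube_det_ge] requires. *)
pose H k (z : 'rV[R]_d) :=
  if z 0 k <= 0 then 0 else if side <= z 0 k then 1 else F k (zpt z).
have HE k z : small (r / 4) z -> H k z = F k (zpt z).
  move=> zr; rewrite /H; case: ifP => [z0|_]; first by rewrite F0.
  by case: ifP => [z1|//]; rewrite F1.
(* The rows of [B] are the z-coordinate directions seen in the chart. *)
pose L (z : 'rV[R]_d) (k a : 'I_d) := 'D_(row a B) (phi k) (x0 + z *m B).
have box_small (z : 'rV[R]_d) : (forall a, 0 <= z 0 a <= side) -> small (r / 4) z.
  by move=> zb a; have /andP[z0 z1] := zb a; rewrite ger0_norm// (le_lt_trans z1).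
have [|||z [/box_small zr zdet]] := @cube_det_ge R d side H L s0.
- by move=> a w wa; rewrite /H wa lexx.
- by move=> a w wa; rewrite /H wa lexx leNgt s0.
- move=> z /box_small zr k a.
  have fst_cvg : p.1 @[p --> filter_prod (0 : R)^'+ (nbhs z)] --> (0 : R)^'+.
    exact: cvg_fst.
  have snd_cvg : p.2 @[p --> filter_prod (0 : R)^'+ (nbhs z)] --> z by exact: cvg_snd.
  have aff_cvg : x0 + p.2 *m B @[p --> filter_prod (0 : R)^'+ (nbhs z)] -->
      x0 + z *m B.
    apply: cvgD; first exact: cvg_cst.
    by apply: mulmx_cvg => //; exact: cvg_cst.
  have step_cvg : p.2 + step p.1 a @[p --> filter_prod (0 : R)^'+ (nbhs z)] --> z.
    rewrite [X in _ --> X](_ : z = z + 0 *: delta_mx 0 a); last by rewrite scale0r addr0.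
    apply: cvgD => //; apply: cvgZ; last exact: cvg_cst.
    exact: cvg_trans fst_cvg (cvg_within _).
  have nz : \forall w \near nbhs z, small (r / 4) w.
    apply: filter_forall => b; apply: (cvgr_norm_lt (z 0 b)); last exact: zr.
    exact: coord_continuous.
  have := C1_quot_cvg (u := row a B) (@chart_img_open _ _ _ A i) (zimg (small4 _ zr)) (FC k i).
  move=> /(cvg_comp _ _ (cvg_pair fst_cvg aff_cvg)); apply: cvg_trans.
  apply: near_eq_cvg; near=> p => /=; rewrite /diff_quot !HE.
  + rewrite /zpoint mulmxDl /step -scalemxAl -rowE addrA.
    by [].
  + by near: p; exact: snd_cvg.
  + by near: p; exact: step_cvg.
have zr' := small4 _ zr.
have pi := zpoint_dom zimg zr'; have xE := chart_zpoint zimg zr'.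
set p := zpt z in pi xE; set x := x0 + z *m B in xE.
have xi : chart_img i x by exact: zimg.
have [_ _ wu _] := omegaS.
pose Gr := \matrix_(k, a) partial a (phi k) x.
have rowGr k : row k Gr = grad (F k) i x by apply/rowP => a; rewrite !mxE.
exists p, (Gr *m (invmx (omega i x))^T *m Gr^T); split=> [k l|].
  rewrite (poisson_bracket_chart omegaS (FC l) (FC k) pi) xE -!rowGr.
  rewrite -row_mul [LHS]mxE [RHS]mxE; apply: eq_bigr => j _.
  by congr (_ * _); [rewrite [RHS]mxE|rewrite !mxE].
have LE : \matrix_(k, a) L z k a = Gr *m B^T.
  apply/matrixP => k a; rewrite !mxE /L derive_partial; last exact: (FC k i).1.
  by apply: eq_bigr => b _; rewrite !mxE mulrC.
rewrite LE det_mulmx det_tr in zdet.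
have G2 := rho_det zr'; rewrite !det_mulmx det_tr -/x in G2.
have dw : `|\det (omega i x)| = `|\det (rho i x)| by exact: compatible_norm_det.
have dw0 : 0 < `|\det (omega i x)| by rewrite normr_gt0 -unitfE -unitmxE wu.
rewrite !det_mulmx !det_tr det_inv !normrM normfV.
move: G2; rewrite !normrM -dw; rewrite normrM in zdet.
set D := `|\det Gr| in zdet *; set b := `|\det B| in zdet *.
set w := `|\det (omega i x)| in dw0 *.
move=> G2; apply: (@le_trans _ _ ((D * b) ^+ 2)).
  by rewrite ler_pXn2r// nnegrE ?invr_ge0 ?exprn_ge0 ?mulr_ge0 ?normr_ge0// ltW.
have -> : (D * b) ^+ 2 = (b * w * b) * (D * w^-1 * D).
  by field; rewrite gt_eqF.
apply: ler_wpM2r => //; first by rewrite !mulr_ge0 ?invr_ge0 ?normr_ge0.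
Unshelve. all: by end_near. Qed.

End Local.

Theorem theorem1p15 (R : realType) (n : nat) (hn : (1 <= n)%N) :
  exists c : R, 0 < c /\
  forall (M : topologicalType) (A : smooth_atlas R (2 * n) M)
         (omega rho : local_matrices A),
    [set: M] !=set0 -> hausdorff_space M -> compact [set: M] ->
    symplectic_form omega ->
    riemannian_metric rho ->
    compatible omega rho ->
    exists delta : R, 0 < delta /\
    forall eps : R, 0 < eps -> eps <= delta ->
    forall (I : finType) (U : I -> set M),
      (forall i, open (U i)) ->
      \bigcup_(i in [set: I]) U i = [set: M] ->
      (forall i, (diameter rho (U i) <= eps%:E)%E) ->
      ((c / eps ^+ 2)%:E <= pb omega U)%E.
Proof.
pose d := (2 * n)%N; pose K : R := d`!%:R.
have K1 : 1 <= K by rewrite ler1n fact_gt0.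
(* Then c / eps^2 = (4 K)^-1 (4 eps)^-2, where 4 eps is the side of the cube; the factor (4 K)^-1
   beats the 2 K of the determinant bounds. *)
pose c := (64 * K)^-1.
have c0 : 0 < c by rewrite invr_gt0; lra.
exists c; split=> // M A omega rho [p0 _] hM _ wS gR compat.
pose i := chart_at A p0; pose x0 := chart i p0.
have x0i : chart_img i x0 := chart_imgP (chart_atP A p0).
have [B Bu [r [r0 zimg gge gdet]]] := metric_normalization gR x0i.
(* Ensures 16 eps < r, both to separate opposite faces and to fit the cube of side 4 eps in the
   range r/4. *)
exists (r / 64); split; first by rewrite divr_gt0.
move=> eps e0 er I U _ _ Ud; apply: le_ereal_inf_tmp => _ [f [fs f0 f1 fU] <-].
rewrite leNgt; apply/negP => bmax.
set m := c / eps ^+ 2 in bmax.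
have m0 : 0 < m by rewrite divr_gt0 ?exprn_gt0.
pose meets (k : 'I_d) (j : I) := `[< exists z, [/\ small (r / 4) z,
  z 0 k <= 0 & U j (zpoint i x0 B z)] >].
pose x (k : 'I_d) (j : I) : R := if meets k j then 0 else 1.
pose F k p := \sum_j x k j * f j p.
have xcube k : unit_cube (x k).
  by move=> j; rewrite /x; case: ifP => _; apply/andP; split; lra.
have fU0 j p : f j p != 0 -> U j p.
  by move=> fp; apply: fU; exact: subset_closure.
have F0 k z : small (r / 4) z -> z 0 k <= 0 -> F k (zpoint i x0 B z) = 0.
  move=> zr zk; apply: big1 => j _; have [->|/fU0 Uz] := eqVneq (f j (zpoint i x0 B z)) 0.
    by rewrite mulr0.
  by rewrite /x ifT ?mul0r//; apply/asboolP; exists z.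
have F1 k z : small (r / 4) z -> 4 * eps <= z 0 k -> F k (zpoint i x0 B z) = 1.
  move=> zr zk; rewrite -(f1 (zpoint i x0 B z)); apply: eq_bigr => j _.
  have [->|/fU0 Uz] := eqVneq (f j (zpoint i x0 B z)) 0; first by rewrite mulr0.
  (* A [U j] reaching both [z 0 k <= 0] and [4 * eps <= z 0 k] would contradict [small_diam_sep]; so
     every [f j] nonzero here is counted in [F k]. *)
  rewrite /x ifF ?mul1r//; apply/asboolPn => -[z0 [z0r z0k Uz0]].
  have er16 : 16 * eps <= r by lra.
  have := small_diam_sep hM gR Bu zimg gge k e0 er16 (Ud j) Uz0 Uz z0r zr.
  lra.
have FC k : C1_fun A (F k).
  by apply: C1_fun_lincomb => j; exact: smooth_fun_C1.
have [||p [P [PE Pdet]]] := grid_functions wS compat zimg gdet _ _ FC F0 F1.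
- lra.
- lra.
have Pm k l : `|P k l| <= m.
  rewrite PE ltW// -lte_fin; apply: le_lt_trans bmax.
  exact: bracket_le_max.
have := norm_det_le Pm; rewrite -/K => Pdet2.
have {Pdet Pdet2} : (4 * eps) ^- d ^+ 2 <= 2 * (K * m ^+ d).
  by apply: le_trans Pdet _; rewrite ler_wpM2l.
apply/negP; rewrite -ltNge.
have -> : m = (4 * K)^-1 * (4 * eps) ^- 2.
  by rewrite /m /c; field; rewrite !gt_eqF//; lra.
rewrite exprMn -!exprVn -!exprM [(d * 2)%N]mulnC.
rewrite mulrA mulrA gtr_pMl ?exprn_gt0 ?invr_gt0//; last lra.
(* As d >= 1 and (4 K)^-1 <= 1, the d-th power is at most the first, and 2 K / (4 K) = 1/2 < 1. *)
apply: (@le_lt_trans _ _ (2 * K * (4 * K)^-1)).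
  rewrite ler_wpM2l//; first by lra.
  rewrite ler_iXnr// ?muln_gt0//; first by rewrite invr_ge0; lra.
  by rewrite invf_le1; lra.
by rewrite ltr_pdivrMr; lra.
Qed.
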